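(* Let $\Omega\subset\mathbb{R}^2$ be a bounded (Lebesgue measurable) set of positive area with $0\in\Omega$ that is star-shaped with respect to the origin, i.e. $tz\in\Omega$ for all $z\in\Omega$ and $t\in[0,1]$. Let $A,B,C,D$ be independent random points uniformly distributed on $\Omega$, let $S_{AB}$ and $S_{CD}$ be the segments with endpoints $A,B$ and $C,D$ respectively, and let $\Theta\in[0,\pi/2]$ be the smaller angle between $S_{AB}$ and $S_{CD}$ whenever the two segments intersect. Then, for every $\theta\in[0,\pi/2]$, \begin{align*} & \mathbb{P}\left(\Theta\leq \theta \,\middle|\, S_{AB} \cap S_{CD} \neq \varnothing\right) = \\ & \quad \frac{1}{\mathbb{P}\left(S_{AB} \cap S_{CD} \neq \varnothing\right)\, \mathrm{Area}(\Omega)^4 } \int_{0}^{2\pi} \int_{0}^{2\pi} \mathbf{1}_{\left\{|\cos(\gamma_{AB}-\gamma_{CD})| \leq \sin \theta\right\}} \\ & \quad\quad \times \int_{0}^{h_{\Omega}(\gamma_{AB})} \int_{0}^{h_{\Omega}(\gamma_{CD})} K_{\Omega}\left(r_{AB},\gamma_{AB}; \frac{r_{AB}\cos(\gamma_{AB}-\gamma_{CD}) - r_{CD}}{\sin(\gamma_{AB}-\gamma_{CD})}\right) \\ & \quad\quad\quad \times K_{\Omega}\left(r_{CD},\gamma_{CD}; \frac{r_{AB} - r_{CD}\cos(\gamma_{AB}-\gamma_{CD})}{\sin(\gamma_{AB}-\gamma_{CD})}\right) \, dr_{CD}\, dr_{AB}\, d\gamma_{CD}\, d\gamma_{AB}, \end{align*}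 where $h_\Omega$ and $K_\Omega$ are the functions attached to $\Omega$ defined in the context.
   Context: The segment with endpoints $A,B$ is $S_{AB}:=\{w\in\mathbb{R}^2: w=(1-\alpha)A+\alpha B,\ \alpha\in[0,1]\}$, and similarly for $S_{CD}$. $\mathbf{1}_E$ denotes the indicator of $E$. The radial function of $\Omega$ is $$\rho_\Omega(\theta):=\sup\{s\ge 0: s(\cos\theta,\sin\theta)^T\in\Omega\},\qquad \theta\in[0,2\pi],$$ extended $2\pi$-periodically to all real angles. For $(a,b)\neq(0,0)$, $\operatorname{atan2}(a,b)\in(-\pi,\pi]$ is the angle $\vartheta$ such that $(\cos\vartheta,\sin\vartheta)=\frac{1}{\sqrt{a^2+b^2}}(b,a)$. For $r\ge 0$, $\gamma\in[0,2\pi]$ and $q\in\mathbb{R}$, define $$S_\Omega(r,\gamma):=\{t\in\mathbb{R}: r^2+t^2\le \rho_\Omega^2(\gamma+\operatorname{atan2}(t,r))\},$$ $$K_\Omega(r,\gamma;q):=\int_{S_\Omega(r,\gamma)}\int_{S_\Omega(r,\gamma)}|u-v|\,\mathbf{1}_{\{(u-q)(v-q)\le 0\}}\,du\,dv,$$ $$h_\Omega(\phi):=\sup_{x\in\Omega}\langle x,(\cos\phi,\sin\phi)^T\rangle=\sup_{\theta\in[0,2\pi]}\rho_\Omega(\theta)\cos(\theta-\phi).$$ The integrand in the claim is defined for almost every $(\gamma_{AB},\gamma_{CD})$, namely when $\sin(\gamma_{AB}-\gamma_{CD})\neq0$; the exceptional null set is ignored.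
   Formalization: The indicator is corrected from |cos(γ_AB−γ_CD)| ≤ sin θ to |sin(γ_AB−γ_CD)| ≤ sin θ: the γ's are normal angles, so the printed indicator describes Θ ≥ π/2−θ, and the printed formula fails for the unit disc and small θ > 0. *)

(* Defs.v *)
From HB Require Import structures.
From mathcomp Require Export all_boot all_order all_algebra.
From mathcomp Require Export all_classical all_reals all_analysis.
Export Order.TTheory GRing.Theory Num.Theory.
Export numFieldNormedType.Exports.

Set Implicit Arguments.
Unset Strict Implicit.
Unset Printing Implicit Defensive.

Local Open Scope classical_set_scope.
Local Open Scope ring_scope.

Section plane.
Variable R : realType.
Implicit Types (x y A B C D : R * R) (Omega : set (R * R)).

Definition dot x y : R := x.1 * y.1 + x.2 * y.2.

(* The library norm on [R * R] is the sup norm. *)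
Definition enorm x : R := Num.sqrt (dot x x).

Definition unit_vec (phi : R) : R * R := (cos phi, sin phi).

Definition scale (s : R) x : R * R := (s * x.1, s * x.2).

(* Two-dimensional Lebesgue outer measure; it is the Lebesgue measure on the
   Lebesgue measurable sets, which are not all measurable for the library's
   (Borel) sigma-algebra on [R * R]. *)
Definition area : set (R * R) -> \bar R :=
  ((@lebesgue_measure R \x @lebesgue_measure R)%E^*)%mu.

Definition lebesgue_measurable_plane : set (set (R * R)) :=
  area.-caratheodory.

Definition star_shaped Omega :=
  forall z t, Omega z -> 0 <= t <= 1 -> Omega (scale t z).

Definition segment A B : set (R * R) :=
  [set w | exists2 alpha : R, 0 <= alpha <= 1 &
             w = scale (1 - alpha) A + scale alpha B].

Definition vec_angle x y : R := acos (dot x y / (enorm x * enorm y)).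

(* Only meaningful when [A != B] and [C != D]. *)
Definition smaller_angle A B C D : R :=
  Num.min (vec_angle (B - A) (D - C)) (pi - vec_angle (B - A) (D - C)).

(* The default value 0 is taken only at [(a, b) = (0, 0)]. *)
Definition atan2 (a b : R) : R :=
  xget 0 [set vartheta | - pi < vartheta <= pi /\
    (cos vartheta, sin vartheta) = scale (Num.sqrt (a ^+ 2 + b ^+ 2))^-1 (b, a)].

Definition radial Omega (theta : R) : R :=
  sup [set s | 0 <= s /\ Omega (scale s (unit_vec theta))].

Definition support_fun Omega (phi : R) : R :=
  sup [set dot x (unit_vec phi) | x in Omega].

Definition chord Omega (r gamma : R) : set R :=
  [set t | r ^+ 2 + t ^+ 2 <= radial Omega (gamma + atan2 t r) ^+ 2].

(* The library integral of a nonnegative function is the supremum of the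
   integrals of the Borel simple functions below it, so on Lebesgue measurable
   functions it is the Lebesgue integral, Borel measurable or not. *)
Definition chord_kernel Omega (r gamma q : R) : \bar R :=
  (\int[lebesgue_measure]_(u in chord Omega r gamma)
   \int[lebesgue_measure]_(v in chord Omega r gamma)
     (`|u - v| * ((u - q) * (v - q) <= 0)%R%:R)%:E)%E.

End plane.

Section probability.
Context d d' (T : measurableType d) (U : measurableType d') (R : realType).
Variable P : probability T R.

Definition mutually_independent (I : finType) (X : I -> {RV P >-> U}) :=
  forall (J : {set I}) (E : I -> set U), (forall i, measurable (E i)) ->
    (P (\bigcap_(i in [set` J]) X i @^-1` E i) =
     \prod_(i in J) P (X i @^-1` E i))%E.

Definition cond_prob (E F : set T) : \bar R := (P (E `&` F) / P F)%E.

End probability.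

Definition uniform_on d (T : measurableType d) (R : realType)
    (P : probability T R) (Omega : set (R * R))
    (X : {RV P >-> (R * R)%type}) :=
  forall E : set (R * R), measurable E ->
    distribution P X E = (area (E `&` Omega) / area Omega)%E.

(* Main.v *)
(** A pair of points of the plane is a pair of points [u], [v] on a line
[<x, e(g)> = r], with [r >= 0], and its area element is [|u - v| du dv dr dg]
(affine Blaschke-Petkantschin formula). It is obtained here from the equation
[y = m x + c] of the line through the two points, by one-dimensional affine
substitutions, then [m = tan x], and by folding the lines with [r < 0] onto
those of normal angle [g + pi]. Two lines with [sin (g1 - g2) <> 0] meet at the
parameters [cut1] and [cut2], so that two segments on them cross if and only if
[(u - q) (v - q) <= 0] on both lines; their smaller angle is at most [theta] if
and only if [|sin (g1 - g2)| <= sin theta]. Tonelli's theorem then gives the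
formula for a Borel set. A star-shaped [Omega] is only Lebesgue measurable and
the inner integrands of the formula need not be measurable, but the integral of
a nonnegative function is monotone without any measurability: the formula for
[Omega] is squeezed between those of two Borel sets of the same area, one inside
[Omega] and one containing all the radial chords of [Omega]. *)

(* The law of the four points sees [Omega] only through the areas of its intersections with Borel
   sets. Every Borel [G] with the same intersection areas therefore gives the same quadruple
   integral [N * a ^+ 4], where [N] is the probability of crossing at an angle at most [theta] and
   [a] is the area. This closes the squeeze: its two ends are one and the same number, and no
   section of [Omega] has to be compared with a chord line by line. Slopes and intercepts serve as
   intermediate coordinates because, for fixed distinct abscissas, the two ordinates are linear in
   them: every Jacobian is then a product of one-variable factors, and only pairs of points with
   equal abscissas, a null set, are lost. *)
From HB Require Import structures.
Require Import Defs.
From mathcomp Require Import measurable_realfun ring lra.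

Set Implicit Arguments.
Unset Strict Implicit.
Unset Printing Implicit Defensive.

Local Open Scope classical_set_scope.
Local Open Scope ring_scope.

(** * Monotonicity of the integral; restricted measures *)

Section integral_complements.
Context d (T : measurableType d) (R : realType).
Variable m : {measure set T -> \bar R}.
Local Open Scope ereal_scope.

(** The integral is a supremum over the simple functions below the integrand, and those below the
    restriction of [f] are also below that of [g]. Comparing restrictions lets the two domains
    differ. *)
Lemma nonneg_le_integral (D E : set T) (f g : T -> \bar R) :
    (forall x, D x -> 0 <= f x) -> (forall x, E x -> 0 <= g x) ->
    (forall x, (f \_ D) x <= (g \_ E) x) ->
  \int[m]_(x in D) f x <= \int[m]_(x in E) g x.
Proof.
move=> f0 g0 fg; rewrite !ge0_integralE//; apply: ge_ereal_sup => _ [h/= hf <-].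
apply: ereal_sup_ubound; exists h => //= x.
exact: le_trans (hf x) (fg x).
Qed.

Lemma ge0_integral_mrestr (D : set T) (mD : measurable D) (f : T -> \bar R) :
    measurable_fun [set: T] f -> (forall x, 0 <= f x) ->
  \int[mrestr m mD]_x f x = \int[m]_(x in D) f x.
Proof.
move=> mf f0; rewrite -(setUv D) ge0_integral_setU//=; last 3 first.
- exact: measurableC.
- by rewrite setUv.
- by rewrite disj_set2E setICr.
rewrite [X in _ + X](_ : _ = 0) ?adde0.
  by apply: eq_measure_integral => A mA AD; rewrite /= /mrestr setIidl.
rewrite -(@integral_measure_zero _ _ R (~` D) f).
apply: eq_measure_integral => A mA AD; rewrite /= /mzero /mrestr.
by have /disjoints_subset -> := AD; rewrite measure0.
Qed.

End integral_complements.

(** * One-dimensional substitutions for the Lebesgue measure *)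

Section lebesgue_substitution.
Variable R : realType.
Local Notation L := (measurableTypeR R).
Local Notation mu := (@lebesgue_measure R).
Local Open Scope ereal_scope.

(** The image of the Lebesgue measure under the translation gives each []b, c]] its length, which
    characterizes the Lebesgue measure. Scaling and [tan] are treated by the same uniqueness. *)
Lemma ge0_integral_translation (a : R) (f : R -> \bar R) :
    measurable_fun [set: R] f -> (forall x, 0 <= f x) ->
  \int[mu]_x f (x + a)%R = \int[mu]_x f x.
Proof.
move=> mf f0.
have ma : measurable_fun [set: R] (fun x : R => x + a)%R.
  exact: measurable_funD.
transitivity (\int[pushforward mu ((fun x : R => x + a)%R : L -> L)]_x f x).
  by rewrite ge0_integral_pushforward.
apply: eq_measure_integral => A mA _; apply/esym/lebesgue_measure_unique => // _ [[b c] /= _ <-].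
rewrite /pushforward (_ : _ @^-1` _ = `](b - a)%R, (c - a)%R]%classic).
  rewrite !lebesgue_measure_itv/= !lte_fin ltrD2r -!EFinB.
  by rewrite (_ : (c - a - (b - a) = c - b)%R)//; ring.
by apply/seteqP; split => x /=; rewrite !in_itv/= ltrBlDr lerBrDr.
Qed.

Lemma ge0_integral_translation_in (a : R) (D : set R) (f : R -> \bar R) :
    measurable D -> measurable_fun [set: R] f -> (forall x, 0 <= f x) ->
  \int[mu]_(x in [set x | D (x + a)%R]) f (x + a)%R = \int[mu]_(x in D) f x.
Proof.
move=> mD mf f0; pose h := f \_ D.
transitivity (\int[mu]_x h (x + a)%R).
  rewrite integral_mkcond; apply: eq_integral => x _.
  by rewrite /h !patchE; congr (if _ then _ else _); apply/idP/idP; rewrite !inE.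
rewrite ge0_integral_translation /h -?integral_mkcond//.
  by apply/(measurable_restrictT f mD); exact: measurable_funTS.
by move=> x; rewrite patchE; case: ifPn.
Qed.

Lemma ge0_integral_scaling (k : R) (f : R -> \bar R) : (k != 0)%R ->
    measurable_fun [set: R] f -> (forall x, 0 <= f x) ->
  `|k|%:E * \int[mu]_x f (k * x)%R = \int[mu]_x f x.
Proof.
move=> k0 mf f0.
have mk : measurable_fun [set: L] (fun x : L => k * x : L)%R.
  exact: measurable_funM.
pose K := NngNum (normr_ge0 k).
pose nu : {measure set (measurableTypeR R) -> \bar R} :=
  measure_function_pushforward__canonical__measure_function_Measure mu mk.
transitivity (\int[mscale K nu]_x f x).
  by rewrite ge0_integral_mscale// ge0_integral_pushforward.
apply: eq_measure_integral => A mA _; apply/esym/lebesgue_measure_unique => // _ [[b c] /= _ <-].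
rewrite /mscale /nu /= /pushforward.
have [kp|kn] := ltP 0%R k.
  rewrite (_ : _ @^-1` _ = `](b / k)%R, (c / k)%R]%classic).
    rewrite !lebesgue_measure_itv/= !lte_fin ltr_pM2r ?invr_gt0//.
    case: ifPn => _; last by rewrite mule0.
    by rewrite -EFinB -EFinM gtr0_norm//; congr EFin; field.
  apply/seteqP; split => x /=; rewrite !in_itv/=.
    by rewrite ltr_pdivrMr// ler_pdivlMr// ![(k * x)%R]mulrC.
  by rewrite ltr_pdivrMr// ler_pdivlMr// ![(k * x)%R]mulrC.
have {}kn : (k < 0)%R by rewrite lt_neqAle k0.
(* For [k < 0] the preimage is half-open on the other side, with the same length. *)
rewrite (_ : _ @^-1` _ = `[(c / k)%R, (b / k)%R[%classic).
  rewrite !lebesgue_measure_itv/= !lte_fin ltr_nM2r ?invr_lt0//.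
  case: ifPn => _; last by rewrite mule0.
  by rewrite -EFinB -EFinM ltr0_norm//; congr EFin; field.
apply/seteqP; split => x /=; rewrite !in_itv/=.
  by rewrite ltr_ndivlMr// ler_ndivrMr// ![(k * x)%R]mulrC andbC.
by rewrite ltr_ndivlMr// ler_ndivrMr// ![(k * x)%R]mulrC andbC.
Qed.

Lemma measurable_invr : measurable_fun [set: R] (@GRing.inv R).
Proof.
rewrite -(setUv [set 0%R]); apply/measurable_funU => //.
  exact: measurableC.
split; first exact: measurable_fun_set1.
apply: open_continuous_measurable_fun.
  by rewrite openC; exact: closed_eq.
by move=> x; rewrite inE /= => /eqP x0; exact: inv_continuous.
Qed.

Lemma measurable_tan : measurable_fun [set: R] (@tan R).
Proof.
apply: measurable_funM.
  by apply: continuous_measurable_fun; exact: continuous_sin.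
apply: (measurableT_comp measurable_invr).
by apply: continuous_measurable_fun; exact: continuous_cos.
Qed.

(** The closed interval from [atan a] to [atan b] avoids the zeros of [cos], so the fundamental
    theorem of calculus applies to [tan]. This is the mass that the density [cos^-2] gives to the
    preimage of []a, b]] under [tan]. *)
Lemma integral_derive_tan (a b : R) : (a <= b)%R ->
  \int[mu]_(x in `](atan a), (atan b)]) ((cos x) ^- 2)%:E = (b - a)%:E.
Proof.
rewrite le_eqVlt => /predU1P[->|ab].
  by rewrite subrr set_itv_ge ?bnd_simp ?ltxx// integral_set0.
have cn0 x : x \in `[atan a, atan b] -> (cos x != 0)%R.
  rewrite in_itv /= => /andP[ax xb]; rewrite gt_eqF//; apply: cos_gt0_pihalf.
  by rewrite (lt_le_trans (atan_gtNpi2 a))//= (le_lt_trans xb)// atan_ltpi2.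
have cc x : x \in `[atan a, atan b] -> {for x, continuous (fun x : R => (cos x) ^- 2)%R}.
  move=> /cn0 c0; apply: continuousV; first by rewrite expf_neq0.
  by apply: (@continuous_comp _ _ _ cos (fun y => y ^+ 2)%R); [exact: continuous_cos|exact: exprn_continuous].
have lt_atan : (atan a < atan b)%R.
  by rewrite -ltr_tan ?atanK// in_itv/= atan_gtNpi2 atan_ltpi2.
rewrite integral_itv_obnd_cbnd; last first.
  apply/measurable_EFinP/measurable_funTS/(measurableT_comp measurable_invr).
  by apply: measurable_funX; apply: continuous_measurable_fun; exact: continuous_cos.
rewrite (@continuous_FTC2 _ _ tan)// ?atanK//.
- by apply: continuous_in_subspaceT => x /[!inE]; exact: cc.
- split.
  + move=> x /subset_itv_oo_cc xab; apply: derivable_tan; exact: cn0.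
  + apply: cvg_at_right_filter; apply: continuous_tan; apply: cn0.
    by rewrite in_itv/= lexx ltW.
  + apply: cvg_at_left_filter; apply: continuous_tan; apply: cn0.
    by rewrite in_itv/= lexx ltW.
- move=> x /subset_itv_oo_cc xab; rewrite derive1E.
  by have /(@derive_val _ _ _ _ _ _ _) := is_derive_tan (cn0 _ xab).
Qed.

Lemma measurable_cosXN2 : measurable_fun [set: R] (fun x : R => (cos x) ^- 2)%R.
Proof.
apply: (measurableT_comp measurable_invr); apply: measurable_funX.
by apply: continuous_measurable_fun; exact: continuous_cos.
Qed.

Definition under_cosXN2 : set (L * L) :=
  [set p | (- (pi / 2) < p.1 < pi / 2) && (0 <= p.2 <= (cos p.1) ^- 2)]%R.

Lemma measurable_under_cosXN2 : measurable under_cosXN2.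
Proof.
rewrite (_ : under_cosXN2 =
  (fun p : L * L => (- (pi / 2) < p.1 < pi / 2) && (0 <= p.2 <= (cos p.1) ^- 2))%R
    @^-1` [set true])//.
rewrite -[X in measurable X]setTI; apply: (_ : measurable_fun _ _) => //.
repeat apply: measurable_and.
- exact: (measurable_fun_ltr _ measurable_fst).
- exact: measurable_fun_ltr measurable_fst _.
- exact: (measurable_fun_ler _ measurable_snd).
- apply: measurable_fun_ler measurable_snd _.
  exact: measurableT_comp measurable_cosXN2 measurable_fst.
Qed.

Lemma xsection_under_cosXN2 (x : R) : (- (pi / 2) < x < pi / 2)%R ->
  mu (xsection under_cosXN2 x) = ((cos x) ^- 2)%:E.
Proof.
move=> xI; rewrite (_ : xsection _ _ = `[0%R, ((cos x) ^- 2)%R]%classic).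
  rewrite lebesgue_measure_itv/= lte_fin.
  by rewrite invr_gt0 exprn_gt0 ?cos_gt0_pihalf// oppr0 adde0.
apply/seteqP; split => y; rewrite /xsection/= inE /under_cosXN2 /= in_itv/= xI//.
Qed.

Lemma lt_atan_tan (a x : R) : (- (pi / 2) < x < pi / 2)%R ->
  (a < tan x)%R = (atan a < x)%R.
Proof.
by move=> xI; rewrite -[in LHS](atanK a) ltr_tan// in_itv/= atan_gtNpi2 atan_ltpi2.
Qed.

Lemma tan_le_atan (a x : R) : (- (pi / 2) < x < pi / 2)%R ->
  (tan x <= a)%R = (x <= atan a)%R.
Proof. by move=> xI; rewrite !leNgt lt_atan_tan. Qed.

(* The density [cos^-2] is realized as the area under its graph: the image of
   the plane measure on this region under [tan \o fst] is Lebesgue's. *)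
Lemma ge0_integral_tan (f : R -> \bar R) :
    measurable_fun [set: R] f -> (forall x, 0 <= f x) ->
  \int[mu]_x f x =
  \int[mu]_(x in `](- (pi / 2))%R, (pi / 2)%R[) (((cos x) ^- 2)%:E * f (tan x)).
Proof.
move=> mf f0.
have mU := measurable_under_cosXN2.
have mt : measurable_fun [set: L * L] (fun p : L * L => tan p.1 : L).
  exact: measurableT_comp measurable_tan measurable_fst.
transitivity (\int[pushforward (mrestr (mu \x mu) mU)
    (fun p : L * L => tan p.1 : L)]_x f x).
  apply: eq_measure_integral => A mA _; apply/lebesgue_measure_unique => //.
  move=> _ [[a b] /= _ <-].
  rewrite /pushforward /mrestr /product_measure1.
  have [ab|ba] := leP a b; last first.
    rewrite (_ : `]a, b]%classic = set0) ?measure0; last first.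
      by rewrite set_itv_ge// bnd_simp -leNgt ltW.
    rewrite preimage_set0 set0I; apply/esym.
    by under eq_integral do rewrite /= xsection0 measure0; rewrite integral0.
  rewrite lebesgue_measure_itv/= lte_fin; transitivity ((b - a)%:E).
    move: ab; rewrite le_eqVlt => /predU1P[->|->//]; by rewrite ltxx subrr.
  rewrite -integral_derive_tan// integral_mkcond; apply: eq_integral => x _ /=.
  rewrite patchE; case: ifPn => [|xab].
    rewrite inE/= in_itv/= => /andP[ax xb].
    have xI : (- (pi / 2) < x < pi / 2)%R.
      by rewrite (lt_trans (atan_gtNpi2 a))//= (le_lt_trans xb)// atan_ltpi2.
    rewrite -xsection_under_cosXN2//; congr (mu _).
    apply/seteqP; split => y; rewrite /xsection/= !inE//=; last by case.
    move=> Uxy; split => //=.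
    by rewrite in_itv/= lt_atan_tan// tan_le_atan// ax xb.
  rewrite (_ : xsection _ _ = set0) ?measure0//.
  apply/seteqP; split => y //; rewrite /xsection/= !inE/= in_itv/= => -[+ Uxy].
  apply/negP; apply: contra xab; rewrite inE/= in_itv/=.
  have xI : (- (pi / 2) < x < pi / 2)%R by case/andP: Uxy.
  by rewrite lt_atan_tan// tan_le_atan.
have mft : measurable_fun [set: L * L] (fun p : L * L => f (tan p.1)).
  exact: measurableT_comp mf mt.
rewrite ge0_integral_pushforward//= preimage_setT ge0_integral_mrestr//.
(* The integrand [f (tan x)] is constant on each vertical section of the region, whose length is
   [cos^-2]. *)
rewrite integral_mkcond fubini_tonelli1//=; last 2 first.
- apply/(measurable_restrictT _ mU); exact: measurable_funTS.
- by move=> p; rewrite patchE; case: ifPn.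
rewrite [RHS]integral_mkcond; apply: eq_integral => x _ /=; rewrite patchE.
case: ifPn => [|xI].
  rewrite inE/= in_itv/= => xI; rewrite -xsection_under_cosXN2//.
  rewrite muleC -integral_cst; last exact: measurable_xsection.
  rewrite [RHS]integral_mkcond; apply: eq_integral => y _.
  by rewrite !patchE /fubini_F/= mem_xsection.
apply: integral0_eq => y _; rewrite patchE; case: ifPn => //.
rewrite inE => /andP[/= xI' _]; exfalso; move/negP: xI; apply.
by rewrite inE/= in_itv/= xI'.
Qed.

Lemma ge0_integral_fold (f : R -> \bar R) :
    measurable_fun [set: R] f -> (forall x, 0 <= f x) ->
  \int[mu]_x f x =
  \int[mu]_(x in `[0%R, +oo[) f x + \int[mu]_(x in `[0%R, +oo[) f (- x)%R.
Proof.
move=> mf f0; have m0 : measurable (`[0%R, +oo[ : set R) by exact: measurable_itv.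
have := @ge0_integral_setU _ _ _ mu _ _ m0 (measurableC m0) f.
rewrite setUv => -> //; last by rewrite disj_set2E setICr.
apply: (congr1 (fun z => _ + z)); rewrite setCitvr integral_itv_bndo_bndc; last first.
  exact: measurable_funTS.
rewrite ge0_integration_by_substitution0//; last first.
  by apply: measurableT_comp => //; exact: oppr_measurable.
by apply: eq_integral => r _; rewrite opprK.
Qed.

(** With [a = pi] it turns a half-turn of lines with signed [r] into a full turn of lines with
    [r >= 0]. Endpoints are null, so open and closed intervals can be exchanged. *)
Lemma ge0_integral_unfold_period (a : R) (f : R -> \bar R) : (0 < a)%R ->
    measurable_fun [set: R] f -> (forall x, 0 <= f x) ->
  \int[mu]_(x in `]0%R, a[) (f x + f (x + a)%R) =
  \int[mu]_(x in `[0%R, (a + a)%R]) f x.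
Proof.
move=> a0 mf f0; rewrite ge0_integralD//; last 2 first.
- exact: measurable_funTS.
- by apply: measurable_funTS; apply: measurableT_comp => //; exact: measurable_funD.
have -> : \int[mu]_(x in `]0%R, a[) f (x + a)%R = \int[mu]_(x in `]a, (a + a)%R[) f x.
  rewrite -(@ge0_integral_translation_in a _ f)//.
  congr (integral _ _ _); apply/seteqP; split => x /=; rewrite !in_itv/=;
    by move=> /andP[? ?]; apply/andP; split; lra.
have mD (D : set R) : measurable_fun D f by exact: measurable_funTS.
rewrite -(@integral_itv_bndoo _ 0%R a f false false)//.
rewrite -(@integral_itv_bndoo _ a (a + a)%R f false false)//.
transitivity (\int[mu]_(x in `]0%R, (a + a)%R]) f x); last first.
  by rewrite !(@integral_itv_bndoo _ 0%R (a + a)%R f)//.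
rewrite [in RHS](@itv_bndbnd_setU _ _ _ (BRight a)) ?bnd_simp; [|exact: ltW|by rewrite lerDr ltW].
rewrite ge0_integral_setU//=; first exact: mD.
rewrite disj_set2E; apply/eqP/seteqP; split => // x /=.
by rewrite !in_itv/= => -[/andP[_ ?] /andP[? _]]; lra.
Qed.

End lebesgue_substitution.

(** * Tonelli's theorem, on whole spaces and on subsets *)

Section tonelli.
Context d1 d2 (T1 : measurableType d1) (T2 : measurableType d2) (R : realType).
Variables (m1 : {sigma_finite_measure set T1 -> \bar R})
  (m2 : {sigma_finite_measure set T2 -> \bar R}) (f : T1 -> T2 -> \bar R).
Hypothesis mf : measurable_fun [set: T1 * T2] (fun p => f p.1 p.2).
Hypothesis f0 : forall x y, (0 <= f x y)%E.
Local Open Scope ereal_scope.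

Lemma measurable_integral : measurable_fun [set: T1] (fun x => \int[m2]_y f x y).
Proof.
exact: (@measurable_fun_fubini_tonelli_F _ _ _ _ _ _ _ mf (fun p => f0 p.1 p.2)).
Qed.

Lemma integral_exchange :
  \int[m1]_x \int[m2]_y f x y = \int[m2]_y \int[m1]_x f x y.
Proof.
exact: (@fubini_tonelli _ _ _ _ _ m1 m2 _ mf (fun p => f0 p.1 p.2)).
Qed.

Lemma integral_prod :
  \int[m1 \x m2]_p f p.1 p.2 = \int[m1]_x \int[m2]_y f x y.
Proof.
exact: (@fubini_tonelli1 _ _ _ _ _ m1 m2 _ mf (fun p => f0 p.1 p.2)).
Qed.

End tonelli.

(** A condition written as a 0/1 factor keeps the integral on the whole space, where Tonelli's
    theorem and the measurability of products apply. *)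
Lemma integral_mkbool d (T : measurableType d) (R : realType)
    (m : {measure set T -> \bar R}) (b : T -> bool) (f : T -> \bar R) :
  (\int[m]_(x in [set x | b x]) f x = \int[m]_x ((b x)%:R%:E * f x))%E.
Proof.
rewrite integral_mkcond; apply: eq_integral => x _; rewrite patchE.
rewrite (_ : (x \in [set x | b x]) = b x); last by apply/idP/idP; rewrite inE.
by case: (b x); rewrite ?mul1e ?mul0e.
Qed.

Section tonelli_in.
Context d1 d2 (T1 : measurableType d1) (T2 : measurableType d2) (R : realType).
Variables (m1 : {sigma_finite_measure set T1 -> \bar R})
  (m2 : {sigma_finite_measure set T2 -> \bar R}) (D1 : set T1) (D2 : set T2).
Hypotheses (mD1 : measurable D1) (mD2 : measurable D2).
Local Open Scope ereal_scope.

Lemma integral_indicE d (T : measurableType d) (m : {measure set T -> \bar R})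
    (D : set T) (f : T -> \bar R) :
  \int[m]_(x in D) f x = \int[m]_x ((\1_D x)%:E * f x).
Proof.
rewrite integral_mkcond; apply: eq_integral => x _; rewrite patchE indicE.
by case: (x \in D); rewrite ?mul1e ?mul0e.
Qed.

Lemma measurable_indic_EFin d (T : measurableType d) (D : set T) :
  measurable D -> measurable_fun setT (fun x => (\1_D x : R)%:E).
Proof. by move=> mD; apply/measurable_EFinP; exact: measurable_indic. Qed.

Lemma measurable_integral_in (f : T1 -> T2 -> \bar R) :
    measurable_fun [set: T1 * T2] (fun p => f p.1 p.2) -> (forall x y, 0 <= f x y) ->
  measurable_fun [set: T1] (fun x => \int[m2]_(y in D2) f x y).
Proof.
move=> mf f0; rewrite (_ : (fun x => _) = fun x =>
    \int[m2]_y ((\1_D2 y)%:E * f x y)); last first.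
  by apply/funext => x; rewrite integral_indicE.
apply: measurable_integral => [|x y]; last by rewrite mule_ge0// lee_fin.
apply: emeasurable_funM => //.
exact: (measurableT_comp (measurable_indic_EFin mD2) measurable_snd).
Qed.

Lemma integral_exchange_in (f : T1 -> T2 -> \bar R) :
    measurable_fun [set: T1 * T2] (fun p => f p.1 p.2) -> (forall x y, 0 <= f x y) ->
  \int[m1]_(x in D1) \int[m2]_(y in D2) f x y =
  \int[m2]_(y in D2) \int[m1]_(x in D1) f x y.
Proof.
move=> mf f0.
have i1 : measurable_fun setT (fun p : T1 * T2 => (\1_D1 p.1 : R)%:E).
  exact: (measurableT_comp (measurable_indic_EFin mD1) measurable_fst).
have i2 : measurable_fun setT (fun p : T1 * T2 => (\1_D2 p.2 : R)%:E).
  exact: (measurableT_comp (measurable_indic_EFin mD2) measurable_snd).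
have h0 (a b : R) x y : (0 <= a)%R -> (0 <= b)%R -> 0 <= a%:E * (b%:E * f x y).
  by move=> a0 b0; rewrite !mule_ge0// lee_fin.
rewrite integral_indicE [RHS]integral_indicE.
transitivity (\int[m1]_x \int[m2]_y ((\1_D1 x)%:E * ((\1_D2 y)%:E * f x y))).
  apply: eq_integral => x _; rewrite integral_indicE ge0_integralZl//.
  - apply: emeasurable_funM; first exact: measurable_indic_EFin.
    exact: (measurable_fun_pair2 (f := fun p => f p.1 p.2)).
  - by move=> y _; rewrite mule_ge0// lee_fin.
rewrite integral_exchange; last 2 first.
- exact: (emeasurable_funM i1 (emeasurable_funM i2 mf)).
- by move=> x y; rewrite h0.
apply: eq_integral => y _; rewrite [X in _ = _ * X]integral_indicE -ge0_integralZl//; last 2 first.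
- apply: emeasurable_funM; first exact: measurable_indic_EFin.
  exact: (measurable_fun_pair1 (f := fun p => f p.1 p.2)).
- by move=> x _; rewrite mule_ge0// lee_fin.
by apply: eq_integral => x _; rewrite muleCA.
Qed.

End tonelli_in.

(** * Automation for nonnegativity and measurability *)

Lemma measurable_bool_natr d (T : measurableType d) (R : realType) (b : T -> bool) :
  measurable_fun setT b -> measurable_fun setT (fun x => (b x)%:R : R).
Proof.
move=> mb; have mn : measurable_fun setT (fun b : bool => b%:R : R) by move=> _ Y _.
exact: measurableT_comp mn mb.
Qed.

Lemma measurable_mem_set d (T : measurableType d) (G : set T) :
  measurable G -> measurable_fun setT (fun x => x \in G).
Proof.
move=> mG; apply: (measurable_fun_bool true); rewrite setTI.
rewrite (_ : _ @^-1` _ = G)//; apply/seteqP; split => x /=; first by move/set_mem.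
by move/mem_set.
Qed.

Lemma measurable_sin_fun (R : realType) : measurable_fun setT (@sin R).
Proof. by apply: continuous_measurable_fun; exact: continuous_sin. Qed.

Lemma measurable_cos_fun (R : realType) : measurable_fun setT (@cos R).
Proof. by apply: continuous_measurable_fun; exact: continuous_cos. Qed.

Lemma measurable_addl (R : realType) (c : R) : measurable_fun setT (+%R c).
Proof.
exact: (@measurable_funD _ _ _ _ (cst c) id (measurable_cst c) (@measurable_id _ _ _)).
Qed.

Ltac nonneg := repeat (intros; cbv beta; lazymatch goal with
  | |- is_true (_ <= integral _ _ _)%E => apply: integral_ge0
  | |- is_true (_ <= _ * _)%E => apply: mule_ge0
  | |- is_true (_ <= EFin _)%E => rewrite lee_fin
  | |- is_true (_ <= `|_|)%R => exact: normr_ge0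
  | |- is_true (_ <= _ * _)%R => apply: mulr_ge0
  | |- is_true (_ <= (nat_of_bool _)%:R)%R => exact: ler0n
  | _ => first [ assumption
    | match goal with H : forall _, is_true (_ <= _)%E |- _ => exact: H end
    | match goal with H : forall _ _, is_true (_ <= _)%E |- _ => exact: H end
    | done ]
  end).

Ltac meas1 := lazymatch goal with
  | |- measurable_fun _ (fun q => q) => exact: measurable_id
  | |- measurable_fun _ (fun _ => ?c) => exact: measurable_cst
  | |- measurable_fun _ (fun q => fst q) => exact: measurable_fst
  | |- measurable_fun _ (fun q => snd q) => exact: measurable_snd
  | |- measurable_fun _ fst => exact: measurable_fst
  | |- measurable_fun _ snd => exact: measurable_snd
  | |- measurable_fun _ (fun q => fst (@?g q)) => apply: (measurableT_comp measurable_fst)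
  | |- measurable_fun _ (fun q => snd (@?g q)) => apply: (measurableT_comp measurable_snd)
  | |- measurable_fun _ (fun q => (@?f q, @?g q)) => apply: measurable_fun_pair
  | |- measurable_fun _ (fun q => EFin (@?g q)) => apply/measurable_EFinP
  | |- measurable_fun _ EFin => exact: EFin_measurable
  | |- measurable_fun _ (fun q => (_ * _)%E) => apply: emeasurable_funM
  | |- measurable_fun _ (fun q => integral _ setT _) =>
      apply: measurable_integral; [lazy beta | by nonneg]
  | |- measurable_fun _ (fun q => integral _ _ _) =>
      apply: measurable_integral_in; [by [] | lazy beta | by nonneg]
  | |- measurable_fun _ (fun q => (_ * _)%R) => apply: measurable_funM
  | |- measurable_fun _ (GRing.mul _) => exact: mulrl_measurable
  | |- measurable_fun _ (fun q => (_ + _)%R) => apply: measurable_funD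
  | |- measurable_fun _ (GRing.add _) => exact: measurable_addl
  | |- measurable_fun _ (fun q => (- _)%R) => apply: (measurableT_comp (@oppr_measurable _ setT))
  | |- measurable_fun _ GRing.opp => exact: oppr_measurable
  | |- measurable_fun _ (fun q => (_ ^-1)%R) => apply: (measurableT_comp (@measurable_invr _))
  | |- measurable_fun _ (fun q => (_ ^+ _)%R) => apply: measurable_funX
  | |- measurable_fun _ (fun q => (`| _ |)%R) => apply: (measurableT_comp (@normr_measurable _ setT))
  | |- measurable_fun _ (fun q => sin _) => apply: (measurableT_comp (@measurable_sin_fun _))
  | |- measurable_fun _ (fun q => cos _) => apply: (measurableT_comp (@measurable_cos_fun _))
  | |- measurable_fun _ (fun q => tan _) => apply: (measurableT_comp (@measurable_tan _))
  | |- measurable_fun _ sin => exact: measurable_sin_fun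
  | |- measurable_fun _ cos => exact: measurable_cos_fun
  | |- measurable_fun _ (fun q => ((_ : bool)%:R)%R) => apply: measurable_bool_natr
  | |- measurable_fun _ (fun q => _ && _) => apply: measurable_and
  | |- measurable_fun _ (fun q => (_ <= _)%R) => apply: measurable_fun_ler
  | |- measurable_fun _ (fun q => (_ < _)%R) => apply: measurable_fun_ltr
  | |- measurable_fun _ (fun q => (_ == _)%R) => apply: measurable_fun_eqr
  end.

(** Besides the syntax-directed rules, it applies closure hypotheses of the context, which say that
    composition with measurable functions on an arbitrary space stays measurable. Hence the many
    local facts quantified over the source space. *)
Ltac meas := repeat first [ assumption | meas1
  | match goal with
    | H : forall (d : measure_display) (T : measurableType d) f g,
        measurable_fun setT f -> measurable_fun setT g -> _ |- _ => apply: H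
    | H : forall (d : measure_display) (T : measurableType d) f,
        measurable_fun setT f -> _ |- _ => apply: H
    | H : forall (d : measure_display) (T : measurableType d) f g h,
        measurable_fun setT f -> _ |- _ => apply: H
    | H : forall (d : measure_display) (T : measurableType d) f g h k,
        measurable_fun setT f -> _ |- _ => apply: H
    end ].

(* Giving the product measure its own head symbol keeps unification tractable. *)
Definition plane_measure (R : realType) :
    set (measurableTypeR R * measurableTypeR R)%type -> \bar R :=
  (@lebesgue_measure R \x @lebesgue_measure R)%E.
HB.instance Definition _ (R : realType) := Measure.on (@plane_measure R).

Lemma plane_measure_sigma_finite (R : realType) :
  sigma_finite setT (@plane_measure R).
Proof.
pose I k : set (measurableTypeR R) := `](- k%:R), k%:R]%classic.
have UI : \bigcup_k I k = setT by rewrite /I bigcup_itvT.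
have nI m n : (m <= n)%N -> I m `<=` I n.
  move=> mn x; rewrite /I/= !in_itv/= => /andP[mx xm].
  have : m%:R <= n%:R :> R by rewrite ler_nat.
  by move=> mnR; rewrite (le_lt_trans _ mx) ?lerN2//= (le_trans xm).
exists (fun k => I k `*` I k) => [|k].
  apply/seteqP; split => // -[x y] _.
  have [m _ mx] : (\bigcup_k I k) x by rewrite UI.
  have [n _ ny] : (\bigcup_k I k) y by rewrite UI.
  by exists (maxn m n) => //; split; [apply: nI mx; rewrite leq_maxl
    |apply: nI ny; rewrite leq_maxr].
have Ioo : (lebesgue_measure (I k) < +oo)%E.
  by rewrite /I lebesgue_measure_itv/=; case: ifPn => _; rewrite ltry.
split; first by apply: measurableX; exact: measurable_itv.
rewrite /plane_measure product_measure1E; [|exact: measurable_itv|exact: measurable_itv].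
by rewrite lte_mul_pinfty// ge0_fin_numE.
Qed.
HB.instance Definition _ (R : realType) :=
  @Measure_isSigmaFinite.Build _ _ _ (@plane_measure R) (@plane_measure_sigma_finite R).

(** * Pairs of points as lines with two parameters *)

Section blaschke_petkantschin.
Variable R : realType.
Local Notation L := (measurableTypeR R).
Local Notation mu := (@lebesgue_measure R).
Local Notation mu2 := (@plane_measure R).
Local Open Scope ereal_scope.

Lemma integral_plane (f : L -> L -> \bar R) :
    measurable_fun [set: L * L] (fun p => f p.1 p.2) -> (forall x y, 0 <= f x y) ->
  \int[mu2]_p f p.1 p.2 = \int[mu]_x \int[mu]_y f x y.
Proof. exact: integral_prod. Qed.

Lemma integral_scale_shift2 (k b : R) (H : L * L -> \bar R) : (k != 0)%R ->
    measurable_fun setT H -> (forall p, 0 <= H p) ->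
  \int[mu2]_p H p =
  (`|k| ^+ 2)%:E * \int[mu2]_p H (k * p.1 + b, k * p.2 + b)%R.
Proof.
move=> k0 mH H0.
have H00 x y : 0 <= H (x, y) by [].
have mH' : measurable_fun setT (fun p : L * L => H (p.1, p.2)).
  by apply: measurableT_comp => //; meas.
have E (f : L -> \bar R) : measurable_fun setT f -> (forall x, 0 <= f x) ->
    \int[mu]_x f x = `|k|%:E * \int[mu]_x f (k * x + b)%R.
  move=> mf f0.
  rewrite -(ge0_integral_translation b mf f0) -(ge0_integral_scaling k0)//.
  by apply: measurableT_comp => //; meas.
have mHk : measurable_fun setT (fun p : L * L => H (p.1, (k * p.2 + b)%R)).
  by apply: measurableT_comp => //; meas.
have mHkk : measurable_fun setT (fun p : L * L => H ((k * p.1 + b)%R, (k * p.2 + b)%R)).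
  by apply: measurableT_comp => //; meas.
transitivity (\int[mu]_x \int[mu]_y H (x, y)).
  rewrite -integral_plane//; by apply: eq_integral => -[].
transitivity (\int[mu]_x (`|k|%:E * \int[mu]_y H (x, (k * y + b)%R))).
  apply: eq_integral => x _; rewrite E//.
  by apply: measurableT_comp => //; meas.
rewrite ge0_integralZl//=; last 2 first.
  by meas.
  by nonneg.
rewrite [X in _ * X]E//; last by nonneg.
  rewrite muleA -EFinM -expr2; congr (_ * _); apply/esym.
  by rewrite (@integral_plane (fun x y => H (k * x + b, k * y + b)%R)).
by meas.
Qed.

(** Shifting [c] by [m * x] makes the first ordinate a variable of its own; the second one becomes
    [m * (y - x) + c], and only a translation and a scaling by [y - x] remain. *)
Lemma integral_slope2 (x y : R) (H : L * L -> \bar R) : (x != y)%R ->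
    measurable_fun setT H -> (forall p, 0 <= H p) ->
  \int[mu2]_p H p =
  `|x - y|%:E * \int[mu2]_p H (p.1 * x + p.2, p.1 * y + p.2)%R.
Proof.
move=> xy mH H0.
have yx : (y - x != 0)%R by rewrite subr_eq0 eq_sym.
have H00 a b : 0 <= H (a, b) by [].
have mHc d (T : measurableType d) (f : T -> L * L) : measurable_fun setT f ->
    measurable_fun setT (fun p => H (f p)).
  by move=> mf; apply: measurableT_comp.
rewrite (@integral_plane (fun m c => H (m * x + c, m * y + c)%R))//; last first.
  by apply: mHc; meas.
transitivity (`|x - y|%:E * \int[mu]_m \int[mu]_c H (c, (m * (y - x) + c)%R)).
  rewrite integral_exchange//; last by apply: mHc; meas.
  rewrite -ge0_integralZl//; last 2 first.
    by apply: measurable_integral => //; apply: mHc; meas.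
    by nonneg.
  transitivity (\int[mu]_c \int[mu]_b H (c, b)).
    rewrite -integral_plane//; last by apply: mHc; meas.
    by apply: eq_integral => -[].
  apply: eq_integral => c _.
  rewrite -(@ge0_integral_translation _ c)//; last by apply: mHc; meas.
  rewrite -(ge0_integral_scaling yx)//; last by apply: mHc; meas.
  by rewrite distrC; congr (_ * _); apply: eq_integral => m _; rewrite [(_ * m)%R]mulrC.
apply: (congr1 (fun z => `|x - y|%:E * z)); apply: eq_integral => m _.
rewrite -(@ge0_integral_translation _ (m * x)%R)//.
by apply: eq_integral => c _; congr (H (_, _)); ring.
by apply: mHc; meas.
Qed.

(** Here [l] is the slope and intercept of the line through [a] and [b], and [p] is the pair of
    their abscissas. For fixed abscissas the Jacobian is that of [integral_slope2]. *)
Lemma integral_lines (F : L * L -> L * L -> \bar R) :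
    measurable_fun setT (fun p => F p.1 p.2) -> (forall a b, 0 <= F a b) ->
  \int[mu2]_a \int[mu2]_b F a b =
  \int[mu2]_l \int[mu2]_p (`|p.1 - p.2|%:E *
     F (p.1, l.1 * p.1 + l.2)%R (p.2, l.1 * p.2 + l.2)%R).
Proof.
move=> mF F0.
have mFc d (T : measurableType d) (f g : T -> L * L) : measurable_fun setT f ->
    measurable_fun setT g -> measurable_fun setT (fun p => F (f p) (g p)).
  by move=> mf mg; exact: (measurableT_comp mF (measurable_fun_pair mf mg)).
rewrite [RHS]integral_exchange; last 2 first.
- by meas.
- by nonneg.
rewrite (@integral_plane (fun x y => \int[mu2]_l (`|x - y|%:E *
     F (x, l.1 * x + l.2)%R (y, l.1 * y + l.2)%R))); last 2 first.
- by meas.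
- by nonneg.
transitivity (\int[mu]_x \int[mu]_y \int[mu2]_p F (x, p.1) (y, p.2)).
  transitivity (\int[mu]_x \int[mu]_x' \int[mu]_y \int[mu]_y' F (x, x') (y, y')).
    rewrite -integral_plane; last 2 first.
    - by meas.
    - by nonneg.
    apply: eq_integral => -[a a'] _ /=; rewrite -integral_plane//; last first.
      by meas.
    by apply: eq_integral => -[].
  apply: eq_integral => x _; rewrite integral_exchange; last 2 first.
  - by meas.
  - by nonneg.
  apply: eq_integral => y _; rewrite (@integral_plane (fun x' y' => F (x, x') (y, y')))//.
  by meas.
apply: eq_integral => x _.
(* The single abscissa [y = x], for which there is no slope, is removed as a null set. *)
have E (f : L -> \bar R) : measurable_fun setT f ->
    \int[mu]_y f y = \int[mu]_(y in setT `\ x) f y.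
  move=> mf; rewrite integral_setD1//; first exact: measurableD.
  exact: measurable_funTS.
rewrite E; last by meas.
rewrite [RHS]E; last by meas.
apply: eq_integral => y; rewrite inE => -[_ /= /eqP yx].
rewrite (@integral_slope2 x y (fun p => F (x, p.1) (y, p.2))) 1?eq_sym//=; last first.
  by meas.
by rewrite ge0_integralZl//; apply: mFc; meas.
Qed.

(** The line with unit normal [unit_vec g] at signed distance [r] from the origin, parametrized by
    arc length from the foot of the perpendicular. *)
Definition line_point (r g t : R) : L * L :=
  (r * cos g - t * sin g, r * sin g + t * cos g)%R.

Lemma measurable_line_point d (T : measurableType d) (r g t : T -> L) :
    measurable_fun setT r -> measurable_fun setT g -> measurable_fun setT t ->
  measurable_fun setT (fun x => line_point (r x) (g x) (t x)).
Proof. by move=> mr mg mt; rewrite /line_point; meas. Qed.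

Lemma line_pointDpi (r g t : R) :
  line_point r (g + pi)%R t = line_point (- r)%R g (- t)%R.
Proof. by rewrite /line_point cosDpi sinDpi; congr (_, _); ring. Qed.

(** Dictionary between the two descriptions of a line: normal angle [x + pi / 2] means slope [tan x]
    and intercept [r / cos x], while arc length moves the abscissa at rate [- cos x]. *)
Lemma tan_line_point (r x u : R) : (cos x != 0)%R ->
  line_point r (x + pi / 2)%R u =
  (- cos x * u - r * sin x, tan x * (- cos x * u - r * sin x) + (cos x)^-1 * r)%R.
Proof.
move=> c0; rewrite /line_point cosDpihalf sinDpihalf /tan; congr (_, _); first by ring.
have := cos2Dsin2 x => cs.
rewrite (_ : r * cos x = r * (cos x ^+ 2 + sin x ^+ 2 - sin x ^+ 2) / cos x)%R.
  by rewrite cs; field.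
by field.
Qed.

Section polar.
Variable F : L * L -> L * L -> \bar R.
Hypothesis mF : measurable_fun setT (fun p => F p.1 p.2).
Hypothesis F0 : forall a b, 0 <= F a b.

Let mFc d (T : measurableType d) (f g : T -> L * L) : measurable_fun setT f ->
  measurable_fun setT g -> measurable_fun setT (fun p => F (f p) (g p)).
Proof. by move=> mf mg; exact: (measurableT_comp mF (measurable_fun_pair mf mg)). Qed.

Definition line_integral (g r : R) : \bar R :=
  \int[mu2]_t (`|t.1 - t.2|%:E * F (line_point r g t.1) (line_point r g t.2)).

Lemma line_integral_ge0 g r : 0 <= line_integral g r.
Proof. by rewrite /line_integral; nonneg. Qed.

Lemma measurable_line_integral d (T : measurableType d) (g r : T -> L) :
    measurable_fun setT g -> measurable_fun setT r ->
  measurable_fun setT (fun x => line_integral (g x) (r x)).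
Proof.
move=> mg mr; rewrite /line_integral.
have mg1 : measurable_fun setT (fun p : T * (L * L) => g p.1).
  by apply: measurableT_comp => //; meas.
have mr1 : measurable_fun setT (fun p : T * (L * L) => r p.1).
  by apply: measurableT_comp => //; meas.
by meas; apply: measurable_line_point => //; meas.
Qed.

(** The triples [(g + pi, r, t)] and [(g, - r, - t)] give the same point, and reflecting both
    parameters has Jacobian [1]. *)
Lemma line_integralDpi (g r : R) :
  line_integral (g + pi)%R r = line_integral g (- r)%R.
Proof.
have mH : measurable_fun setT (fun t : L * L => `|t.1 - t.2|%:E *
    F (line_point (- r)%R g t.1) (line_point (- r)%R g t.2)).
  by meas; apply: measurable_line_point; meas.
rewrite /line_integral [RHS](@integral_scale_shift2 (-1)%R 0%R _ _ mH); last 2 first.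
- by rewrite oppr_eq0 oner_neq0.
- by nonneg.
rewrite normrN1 expr1n mul1e; apply: eq_integral => t _.
by rewrite !line_pointDpi !mulN1r !addr0 -opprD normrN.
Qed.

(** Two factors [cos x] come from the substitution in the two abscissas, the third one from
    [|p.1 - p.2|], which is [cos x] times the distance of the arc lengths. *)
Lemma line_integral_slope (x r : R) : (0 < cos x)%R ->
  \int[mu2]_p (`|p.1 - p.2|%:E * F (p.1, tan x * p.1 + (cos x)^-1 * r)%R
     (p.2, tan x * p.2 + (cos x)^-1 * r)%R) =
  (cos x ^+ 3)%:E * line_integral (x + pi / 2)%R r.
Proof.
move=> c0; have cn0 : (cos x != 0)%R by rewrite gt_eqF.
have mH : measurable_fun setT (fun p : L * L => `|p.1 - p.2|%:E *
    F (p.1, tan x * p.1 + (cos x)^-1 * r)%R (p.2, tan x * p.2 + (cos x)^-1 * r)%R)%E.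
  by meas.
rewrite (@integral_scale_shift2 (- cos x)%R (- (r * sin x))%R _ _ mH); last 2 first.
- by rewrite oppr_eq0.
- by nonneg.
rewrite normrN gtr0_norm// (exprSr _ 2) (EFinM (cos x ^+ 2)) -muleA.
apply: (congr1 (fun z => (cos x ^+ 2)%:E * z)).
rewrite /line_integral -ge0_integralZl//; last 3 first.
- by meas; apply: measurable_line_point; meas.
- by nonneg.
- by rewrite lee_fin ltW.
apply: eq_integral => t _; rewrite muleA -EFinM /= !tan_line_point//.
rewrite (_ : - cos x * t.1 - r * sin x - (- cos x * t.2 - r * sin x) =
  - cos x * (t.1 - t.2))%R; last by ring.
by rewrite normrM normrN (gtr0_norm c0).
Qed.

Theorem integral_polar_lines :
  \int[mu2]_a \int[mu2]_b F a b =
  \int[mu]_(g in `[0%R, (2 * pi)%R]) \int[mu]_(r in `[0%R, +oo[) line_integral g r.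
Proof.
have mLI d (T : measurableType d) (g r : T -> L) : measurable_fun setT g ->
  measurable_fun setT r -> measurable_fun setT (fun x => line_integral (g x) (r x)).
  exact: measurable_line_integral.
have LI0 := line_integral_ge0.
rewrite integral_lines//.
rewrite (@integral_plane (fun m c => \int[mu2]_p (`|p.1 - p.2|%:E *
     F (p.1, m * p.1 + c)%R (p.2, m * p.2 + c)%R))); last 2 first.
- by meas.
- by nonneg.
rewrite ge0_integral_tan; last 2 first.
- by meas.
- by nonneg.
transitivity (\int[mu]_(x in `](- (pi / 2))%R, (pi / 2)%R[)
    \int[mu]_r line_integral (x + pi / 2)%R r).
  apply: eq_integral => x; rewrite inE /= in_itv/= => xI.
  have c0 : (0 < cos x)%R by exact: cos_gt0_pihalf.
  have cn0 : (cos x != 0)%R by rewrite gt_eqF.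
  have cv0 : ((cos x)^-1 != 0)%R by rewrite invr_eq0.
  rewrite -(ge0_integral_scaling cv0); last 2 first.
  - by meas.
  - by nonneg.
  under eq_integral do rewrite line_integral_slope//.
  rewrite ge0_integralZl//; last 2 first.
  - by meas.
  - by rewrite lee_fin exprn_ge0// ltW.
  (* The factors [cos^-2] of [m = tan x] and [cos^-1] of [c = r / cos x] cancel the [cos^3] of
     [line_integral_slope]. *)
  rewrite !muleA -!EFinM gtr0_norm ?invr_gt0// (_ : _ * _ = 1)%R ?mul1e//.
  by field.
have mG d (T : measurableType d) (g : T -> L) : measurable_fun setT g ->
    measurable_fun setT (fun x => \int[mu]_r line_integral (g x) r).
  move=> mg; have mg1 : measurable_fun setT (fun p : T * L => g p.1).
    by apply: measurableT_comp => //; meas.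
  by meas.
(* From the angle of the slope to that of the normal, a quarter turn further. *)
transitivity (\int[mu]_(g in `]0%R, pi[) \int[mu]_r line_integral g r).
  have mG1 := mG _ _ _ (@measurable_id _ L setT).
  rewrite -(@ge0_integral_translation_in _ (pi / 2) _ _ _ mG1)//; last first.
    by nonneg.
  congr (integral _ _ _); apply/seteqP; split => x /=; rewrite !in_itv/=;
    by move=> /andP[? ?]; apply/andP; split; lra.
pose Gp g := \int[mu]_(r in `[0%R, +oo[) line_integral g r.
have GpE g : Gp g = \int[mu]_r ((0 <= r)%R%:R%:E * line_integral g r).
  rewrite -integral_mkbool /Gp; congr (integral _ _ _).
  by apply/seteqP; split => r /=; rewrite in_itv/= andbT.
have mGp d (T : measurableType d) (g : T -> L) : measurable_fun setT g ->
    measurable_fun setT (fun x => Gp (g x)).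
  move=> mg; rewrite (_ : (fun x => _) = fun x =>
    \int[mu]_r ((0 <= r)%R%:R%:E * line_integral (g x) r)); last first.
    by apply/funext => x; rewrite GpE.
  have mg1 : measurable_fun setT (fun p : T * L => g p.1).
    by apply: measurableT_comp => //; meas.
  by meas.
have Gp0 g : 0 <= Gp g by rewrite GpE; nonneg.
have mLI1 g : measurable_fun [set: L] (fun r : L => line_integral g r) by meas.
have mGp1 : measurable_fun [set: L] (fun g : L => Gp g) by apply: mGp; meas.
(* Up to the null value [r = 0], the lines with [r < 0] at angle [g] are those with [r > 0] at angle
   [g + pi]. *)
have GE g : \int[mu]_r line_integral g r = Gp g + Gp (g + pi)%R.
  rewrite (ge0_integral_fold (mLI1 g) (LI0 g)); apply: (congr1 (fun z => Gp g + z)).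
  by apply: eq_integral => r _; rewrite line_integralDpi.
under eq_integral do rewrite GE.
rewrite (ge0_integral_unfold_period (@pi_gt0 R) mGp1 Gp0).
by rewrite (_ : (2 * pi)%R = (pi + pi)%R); last by rewrite mulr_natl mulr2n.
Qed.

End polar.

End blaschke_petkantschin.

(** * The integral over four points in line coordinates *)

Section quadruple.
Variable R : realType.
Local Notation L := (measurableTypeR R).
Local Notation mu := (@lebesgue_measure R).
Local Notation mu2 := (@plane_measure R).
Local Open Scope ereal_scope.

Definition cut_weight (u v q : R) : R := (`|u - v| * ((u - q) * (v - q) <= 0)%R%:R)%R.

Lemma cut_weight_ge0 u v q : (0 <= cut_weight u v q)%R.
Proof. by rewrite /cut_weight mulr_ge0. Qed.

Lemma measurable_cut_weight d (T : measurableType d) (u v q : T -> L) :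
    measurable_fun setT u -> measurable_fun setT v -> measurable_fun setT q ->
  measurable_fun setT (fun x => cut_weight (u x) (v x) (q x)).
Proof. by move=> mu' mv mq; rewrite /cut_weight; meas. Qed.

Section fixed_set.
Variable G : L * L -> bool.
Hypothesis mG : measurable_fun setT G.

Let mGc d (T : measurableType d) (f : T -> L * L) : measurable_fun setT f ->
  measurable_fun setT (fun p => G (f p)).
Proof. by move=> mf; exact: (measurableT_comp mG mf). Qed.

Let mlp := @measurable_line_point R.
Let mcw := measurable_cut_weight.

Definition bool_kernel (r g q : R) (t : L * L) : \bar R :=
  (G (line_point r g t.1))%:R%:E * ((G (line_point r g t.2))%:R%:E *
    (cut_weight t.1 t.2 q)%:E).

Lemma bool_kernel_ge0 r g q t : 0 <= bool_kernel r g q t.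
Proof. by rewrite /bool_kernel !mule_ge0// lee_fin// cut_weight_ge0. Qed.

Lemma measurable_bool_kernel d (T : measurableType d) (r g q : T -> L) (t : T -> L * L) :
    measurable_fun setT r -> measurable_fun setT g -> measurable_fun setT q ->
    measurable_fun setT t ->
  measurable_fun setT (fun x => bool_kernel (r x) (g x) (q x) (t x)).
Proof. by move=> mr mg mq mt; rewrite /bool_kernel; meas. Qed.

(** The counterpart of [chord_kernel] for the section of [G] by a line. As a plane integral of a
    jointly measurable function, it is measurable in [r], [g] and [q]. *)
Definition set_kernel (r g q : R) : \bar R := \int[mu2]_t bool_kernel r g q t.

Lemma set_kernel_ge0 r g q : 0 <= set_kernel r g q.
Proof. by apply: integral_ge0 => t _; exact: bool_kernel_ge0. Qed.

Lemma measurable_set_kernel d (T : measurableType d) (r g q : T -> L) :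
    measurable_fun setT r -> measurable_fun setT g -> measurable_fun setT q ->
  measurable_fun setT (fun x => set_kernel (r x) (g x) (q x)).
Proof.
move=> mr mg mq; rewrite /set_kernel; apply: measurable_integral => [|*]; last first.
  exact: bool_kernel_ge0.
by apply: measurable_bool_kernel;
  [apply: (measurableT_comp mr)|apply: (measurableT_comp mg)
  |apply: (measurableT_comp mq)|]; meas.
Qed.

Lemma set_kernelE r g q : set_kernel r g q =
  \int[mu]_(u in [set u | G (line_point r g u)])
    \int[mu]_(v in [set v | G (line_point r g v)]) (cut_weight u v q)%:E.
Proof.
rewrite /set_kernel (@integral_plane _ (fun u v => bool_kernel r g q (u, v))); last 2 first.
- by apply: measurable_bool_kernel; meas.
- by move=> *; exact: bool_kernel_ge0.
rewrite [RHS]integral_mkbool; apply: eq_integral => u _.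
rewrite integral_mkbool -ge0_integralZl//; last 2 first.
- by meas.
- by move=> v _; rewrite mule_ge0// lee_fin// cut_weight_ge0.
Qed.

End fixed_set.

(** Differences of two angles of [[0, 2 pi]] lie in this range, where the sine has five zeros. For
    fixed [g1], the angles [g2] of parallel lines thus form a finite set, which is null. *)
Lemma sin_neq0_bounded (x : R) : (- (2 * pi) <= x <= 2 * pi)%R ->
    x \notin [:: - (2 * pi); - pi; 0; pi; 2 * pi]%R -> (sin x != 0)%R.
Proof.
have pos y : (0 <= y <= 2 * pi)%R -> y != 0%R -> y != pi -> (y != 2 * pi)%R -> (sin y != 0)%R.
  move=> /andP[y0 y2] n0 n1 n2.
  have {}y0 : (0 < y)%R by rewrite lt_neqAle eq_sym n0.
  have {}y2 : (y < 2 * pi)%R by rewrite lt_neqAle n2.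
  have [yp|yp|yp] := ltgtP y pi; last by rewrite yp eqxx in n1.
    by rewrite gt_eqF// sin_gt0_pi// y0.
  rewrite -(subrK pi y) sinDpi oppr_eq0 gt_eqF// sin_gt0_pi//.
  by apply/andP; split; lra.
move=> /andP[x1 x2]; rewrite !inE !negb_or => /and5P[n1 n2 n3 n4 n5].
have [x0|x0] := leP 0%R x; first by apply: pos => //; rewrite x0.
rewrite -oppr_eq0 -sinN; apply: pos.
- by apply/andP; split; lra.
- by rewrite oppr_eq0.
- by rewrite eqr_oppLR.
- by rewrite eqr_oppLR.
Qed.

Section integral_quadruple.
Variables (G : L * L -> bool) (s : L * L -> L * L -> L * L -> L * L -> bool) (c : R).
Hypothesis mG : measurable_fun setT G.
Hypothesis ms : forall d (T : measurableType d) (a1 a2 a3 a4 : T -> L * L),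
  measurable_fun setT a1 -> measurable_fun setT a2 -> measurable_fun setT a3 ->
  measurable_fun setT a4 -> measurable_fun setT (fun x => s (a1 x) (a2 x) (a3 x) (a4 x)).

Definition cut1 (g1 g2 r1 r2 : R) : R := ((r1 * cos (g1 - g2) - r2) / sin (g1 - g2))%R.
Definition cut2 (g1 g2 r1 r2 : R) : R := ((r1 - r2 * cos (g1 - g2)) / sin (g1 - g2))%R.

Hypothesis sE : forall g1 g2 r1 r2 u v u' v', (sin (g1 - g2) != 0)%R -> (u != v)%R ->
  (u' != v')%R ->
  s (line_point r1 g1 u) (line_point r1 g1 v) (line_point r2 g2 u') (line_point r2 g2 v') =
  [&& `|sin (g1 - g2)| <= c, (u - cut1 g1 g2 r1 r2) * (v - cut1 g1 g2 r1 r2) <= 0 &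
      (u' - cut2 g1 g2 r1 r2) * (v' - cut2 g1 g2 r1 r2) <= 0]%R.

Let mlp := @measurable_line_point R.
Let mbk := measurable_bool_kernel mG.
Let msk := measurable_set_kernel mG.

Let mGc d (T : measurableType d) (f : T -> L * L) : measurable_fun setT f ->
  measurable_fun setT (fun p => G (f p)).
Proof. by move=> mf; exact: (measurableT_comp mG mf). Qed.

Definition quad_indic (a1 a2 a3 a4 : L * L) : \bar R :=
  ((G a1)%:R * (G a2)%:R * (G a3)%:R * (G a4)%:R * (s a1 a2 a3 a4)%:R)%:E.

Let mq d (T : measurableType d) (a1 a2 a3 a4 : T -> L * L) :
  measurable_fun setT a1 -> measurable_fun setT a2 -> measurable_fun setT a3 ->
  measurable_fun setT a4 ->
  measurable_fun setT (fun x => quad_indic (a1 x) (a2 x) (a3 x) (a4 x)).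
Proof. by move=> m1 m2 m3 m4; rewrite /quad_indic; meas. Qed.

Let q0 a1 a2 a3 a4 : 0 <= quad_indic a1 a2 a3 a4.
Proof. by rewrite lee_fin !mulr_ge0. Qed.

Let J g1 r1 (t : L * L) g2 r2 (t' : L * L) : \bar R :=
  `|t.1 - t.2|%:E * (`|t'.1 - t'.2|%:E *
    quad_indic (line_point r1 g1 t.1) (line_point r1 g1 t.2)
      (line_point r2 g2 t'.1) (line_point r2 g2 t'.2)).

Let J0 g1 r1 t g2 r2 t' : 0 <= J g1 r1 t g2 r2 t'.
Proof. by rewrite /J !mule_ge0// lee_fin. Qed.

Let mJ d (T : measurableType d) (g1 r1 g2 r2 : T -> L) (t t' : T -> L * L) :
  measurable_fun setT g1 -> measurable_fun setT r1 -> measurable_fun setT t ->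
  measurable_fun setT g2 -> measurable_fun setT r2 -> measurable_fun setT t' ->
  measurable_fun setT (fun x => J (g1 x) (r1 x) (t x) (g2 x) (r2 x) (t' x)).
Proof. by move=> ? ? ? ? ? ?; rewrite /J; meas. Qed.

(** Hypothesis [sE] covers distinct parameters only; when [t.1 = t.2] or [t'.1 = t'.2] both sides
    vanish through the distance factor. *)
Let JE g1 r1 t g2 r2 t' : (sin (g1 - g2) != 0)%R ->
  J g1 r1 t g2 r2 t' =
  (`|sin (g1 - g2)| <= c)%R%:R%:E * bool_kernel G r1 g1 (cut1 g1 g2 r1 r2) t *
    bool_kernel G r2 g2 (cut2 g1 g2 r1 r2) t'.
Proof.
move=> s0; rewrite /J /bool_kernel /quad_indic /cut_weight -!EFinM; congr EFin.
have [->|tn] := eqVneq t.1 t.2; first by rewrite subrr normr0; ring.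
have [->|tn'] := eqVneq t'.1 t'.2; first by rewrite subrr normr0; ring.
by rewrite sE// -!mulnb !natrM; ring.
Qed.

(** Once the two lines are fixed, the crossing condition separates into one condition on each pair
    of parameters: this is where the product of two kernels comes from. *)
Let JintE g1 r1 g2 r2 : (sin (g1 - g2) != 0)%R ->
  \int[mu2]_t \int[mu2]_t' J g1 r1 t g2 r2 t' =
  (`|sin (g1 - g2)| <= c)%R%:R%:E * (set_kernel G r1 g1 (cut1 g1 g2 r1 r2) *
    set_kernel G r2 g2 (cut2 g1 g2 r1 r2)).
Proof.
move=> s0; have bk0 := @bool_kernel_ge0 G.
set b := (`|sin (g1 - g2)| <= c)%R.
transitivity (\int[mu2]_t (b%:R%:E * (bool_kernel G r1 g1 (cut1 g1 g2 r1 r2) t *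
    set_kernel G r2 g2 (cut2 g1 g2 r1 r2)))).
  apply: eq_integral => t _; rewrite muleA -ge0_integralZl//; last 2 first.
  - by apply: mbk; meas.
  - by rewrite mule_ge0// lee_fin.
  by apply: eq_integral => t' _; rewrite JE.
rewrite ge0_integralZl//; last 2 first.
- by meas.
- by move=> t _; rewrite mule_ge0// set_kernel_ge0.
rewrite ge0_integralZr//; last 2 first.
- by apply: mbk; meas.
- exact: set_kernel_ge0.
Qed.

Theorem integral_quadruple :
  \int[mu2]_a1 \int[mu2]_a2 \int[mu2]_a3 \int[mu2]_a4 quad_indic a1 a2 a3 a4 =
  \int[mu]_(g1 in `[0%R, (2 * pi)%R]) \int[mu]_(g2 in `[0%R, (2 * pi)%R])
    ((`|sin (g1 - g2)| <= c)%R%:R%:E *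
     \int[mu]_(r1 in `[0%R, +oo[) \int[mu]_(r2 in `[0%R, +oo[)
       (set_kernel G r1 g1 (cut1 g1 g2 r1 r2) * set_kernel G r2 g2 (cut2 g1 g2 r1 r2))).
Proof.
have sk0 := @set_kernel_ge0 G.
(* The pair [(a3, a4)] is put in line coordinates first; what remains is then a function of the pair
   [(a1, a2)]. *)
transitivity (\int[mu2]_a1 \int[mu2]_a2
  \int[mu]_(g2 in `[0%R, (2 * pi)%R]) \int[mu]_(r2 in `[0%R, +oo[)
    \int[mu2]_t' (`|t'.1 - t'.2|%:E *
      quad_indic a1 a2 (line_point r2 g2 t'.1) (line_point r2 g2 t'.2))).
  apply: eq_integral => a1 _; apply: eq_integral => a2 _.
  by rewrite integral_polar_lines//; meas.
rewrite integral_polar_lines; last 2 first.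
- by meas.
- by nonneg.
transitivity (\int[mu]_(g1 in `[0%R, (2 * pi)%R]) \int[mu]_(r1 in `[0%R, +oo[)
  \int[mu2]_t \int[mu]_(g2 in `[0%R, (2 * pi)%R]) \int[mu]_(r2 in `[0%R, +oo[)
    \int[mu2]_t' J g1 r1 t g2 r2 t').
  apply: eq_integral => g1 _; apply: eq_integral => r1 _; apply: eq_integral => t _.
  rewrite -ge0_integralZl//; last 2 first.
  - by apply: measurable_funTS; meas.
  - by nonneg.
  apply: eq_integral => g2 _; rewrite -ge0_integralZl//; last 2 first.
  - by apply: measurable_funTS; meas.
  - by nonneg.
  apply: eq_integral => r2 _; rewrite -ge0_integralZl//; last 2 first.
  - by meas.
  - by nonneg.
have mI : measurable (`[0%R, (2 * pi)%R] : set L) by exact: measurable_itv.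
have mP : measurable (`[0%R, +oo[ : set L) by exact: measurable_itv.
apply: eq_integral => g1 /[!inE]/= /[!in_itv]/= /andP[g10 g12].
(* Both angles are moved outside the distances and parameters, because the factorization of [J]
   holds only for almost every [g2]. *)
transitivity (\int[mu]_(g2 in `[0%R, (2 * pi)%R]) \int[mu]_(r1 in `[0%R, +oo[)
  \int[mu]_(r2 in `[0%R, +oo[) \int[mu2]_t \int[mu2]_t' J g1 r1 t g2 r2 t').
  rewrite -(integral_exchange_in _ _ mP mI); last 2 first.
  - by meas; apply: mJ; meas.
  - by nonneg.
  apply: eq_integral => r1 _.
  rewrite (integral_exchange_in _ _ measurableT mI); last 2 first.
  - by meas; apply: mJ; meas.
  - by nonneg.
  apply: eq_integral => g2 _.
  rewrite (integral_exchange_in _ _ measurableT mP)//; last 2 first.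
  - by meas; apply: mJ; meas.
  - by nonneg.
apply: ge0_ae_eq_integral => //.
- by apply: measurable_funTS; meas; apply: mJ; meas.
- by apply: measurable_funTS; rewrite /cut1 /cut2; meas.
- by nonneg.
- by nonneg.
(* [N] contains every [g2] of the range for which [sin (g1 - g2)] vanishes. *)
pose N := [set` [seq (g1 - x)%R | x <- [:: - (2 * pi); - pi; 0; pi; 2 * pi]%R]].
exists N; split.
- apply: countable_measurable => //; exact/finite_set_countable/finite_seq.
- by apply: countable_lebesgue_measure0; exact/finite_set_countable/finite_seq.
move=> g2; apply: contra_notP => /= g2N; rewrite in_itv/= => /andP[g20 g22].
have s0 : (sin (g1 - g2) != 0)%R.
  apply: sin_neq0_bounded; first by apply/andP; split; lra.
  apply/negP => g2i; apply: g2N; apply/mapP; exists (g1 - g2)%R => //.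
  by rewrite opprB addrCA subrr addr0.
rewrite -ge0_integralZl//; last 2 first.
- by apply: measurable_funTS; rewrite /cut1 /cut2; meas.
- by nonneg.
apply: eq_integral => r1 _; rewrite -ge0_integralZl//; last 2 first.
- by apply: measurable_funTS; rewrite /cut1 /cut2; meas.
- by nonneg.
by apply: eq_integral => r2 _; rewrite JintE.
Qed.

End integral_quadruple.
End quadruple.

(** * The smaller angle between two segments *)

Section angle.
Variable R : realType.
Local Notation L := (measurableTypeR R).
Implicit Types x y A B C D : R * R.

Definition abs_cos x y : R := `|dot x y / (enorm x * enorm y)|.

Lemma enormM x y : enorm x * enorm y = Num.sqrt (dot x x * dot y y).
Proof. by rewrite /enorm sqrtrM// /dot addr_ge0 ?sqr_ge0//. Qed.

(** Cauchy-Schwarz through Lagrange's identity: the defect is the square of the determinant of [x]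
    and [y]. *)
Lemma abs_cos_le1 x y : abs_cos x y <= 1.
Proof.
rewrite /abs_cos enormM; set n := dot x x * dot y y.
have n0 : 0 <= n by rewrite mulr_ge0// /dot addr_ge0// ?sqr_ge0//.
have [->|nn0] := eqVneq n 0; first by rewrite sqrtr0 invr0 mulr0 normr0.
have s0 : 0 < Num.sqrt n by rewrite sqrtr_gt0 lt_neqAle eq_sym nn0.
rewrite normrM normfV (gtr0_norm s0) ler_pdivrMr// mul1r -sqrtr_sqr ler_wsqrtr//.
rewrite /n -subr_ge0 (_ : _ - _ = (x.1 * y.2 - x.2 * y.1) ^+ 2) ?sqr_ge0//.
by rewrite /dot; ring.
Qed.

(** With [alpha] the angle of the vectors, the minimum is at most [theta] when [alpha <= theta] or
    [pi - theta <= alpha], that is, when [cos alpha] is at least [cos theta] or at most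
    [- cos theta]. For a degenerate segment the division by zero gives [0], hence an angle [pi / 2],
    on both sides. *)
Lemma smaller_angle_le A B C D (theta : R) : 0 <= theta <= pi / 2 ->
  (smaller_angle A B C D <= theta) = (cos theta <= abs_cos (B - A) (D - C)).
Proof.
move=> /andP[t0 t1]; have pi0 := @pi_gt0 R.
have := abs_cos_le1 (B - A) (D - C).
rewrite /smaller_angle /vec_angle /abs_cos; set z := _ / _ => z1.
have zI : -1 <= z <= 1 by rewrite -ler_norml.
have cosle (a b : R) : 0 <= a <= pi -> 0 <= b <= pi -> (cos b <= cos a) = (a <= b).
  by move=> aI bI; rewrite !leNgt ltr_cos// in_itv.
have aI : 0 <= acos z <= pi by rewrite acos_ge0// acos_lepi.
have zc : cos (acos z) = z by rewrite acosK// in_itv.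
have -> : (Num.min (acos z) (pi - acos z) <= theta) =
    (acos z <= theta) || (pi - theta <= acos z).
  by rewrite ge_min; congr (_ || _); apply/idP/idP; lra.
rewrite -cosle//; last by apply/andP; split; lra.
rewrite -[X in _ || X]cosle//; last by apply/andP; split; lra.
by rewrite zc addrC cosDpi cosN lerNr ler_normr.
Qed.

Lemma measurable_abs_cos d (T : measurableType d) (f1 f2 f3 f4 : T -> L) :
    measurable_fun setT f1 -> measurable_fun setT f2 -> measurable_fun setT f3 ->
    measurable_fun setT f4 ->
  measurable_fun setT (fun t => abs_cos (f1 t, f2 t) (f3 t, f4 t)).
Proof.
move=> m1 m2 m3 m4; rewrite /abs_cos /enorm /dot /=.
have ms : measurable_fun setT (@Num.sqrt R).
  by apply: continuous_measurable_fun; exact: sqrt_continuous.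
meas; apply: (measurableT_comp ms); meas.
Qed.

(** Displacements along a line are multiples of its unit tangent, and the tangents of two lines make
    the same angle as their normals. *)
Lemma abs_cos_line_point (r1 r2 g1 g2 u v u' v' : R) : u != v -> u' != v' ->
  abs_cos (line_point r1 g1 v - line_point r1 g1 u)
    (line_point r2 g2 v' - line_point r2 g2 u') = `|cos (g1 - g2)|.
Proof.
move=> uv uv'.
have dE r r' g g' a b a' b' :
    dot (line_point r g b - line_point r g a) (line_point r' g' b' - line_point r' g' a') =
    (b - a) * (b' - a') * cos (g - g').
  by rewrite /dot /line_point /= cosB; ring.
have nE r g a b : enorm (line_point r g b - line_point r g a) = `|b - a|.
  by rewrite /enorm dE subrr cos0 mulr1 -expr2 sqrtr_sqr.
rewrite /abs_cos dE !nE -normrM; set k := (v - u) * (v' - u').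
have k0 : `|k| != 0 by rewrite normr_eq0 mulf_neq0// subr_eq0 eq_sym.
by rewrite 2!normrM normfV normr_id mulrAC divff// mul1r.
Qed.

(** This gives the indicator of the formula. At [theta = 0] it keeps the parallel directions, as it
    should; bounding [|cos a|] by [sin theta] would keep the perpendicular ones. *)
Lemma cos_le_norm_cos (a theta : R) : 0 <= theta <= pi / 2 ->
  (cos theta <= `|cos a|) = (`|sin a| <= sin theta).
Proof.
move=> /andP[t0 t1]; have pi0 := @pi_gt0 R.
have c0 : 0 <= cos theta by apply: cos_ge0_pihalf; apply/andP; split; lra.
have s0 : 0 <= sin theta by apply: sin_ge0_pi; apply/andP; split; lra.
have le2 (x y : R) : 0 <= x -> 0 <= y -> (x <= y) = (x ^+ 2 <= y ^+ 2).
  by move=> x0 y0; rewrite ler_pXn2r.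
rewrite le2// [RHS]le2// !real_normK ?num_real//.
by have := cos2Dsin2 a; have := cos2Dsin2 theta => ? ?; apply/idP/idP; lra.
Qed.

End angle.

(** * Meeting of two segments, and measurability of this event *)

Section meeting_segments.
Variable R : realType.
Local Notation L := (measurableTypeR R).
Implicit Types A B C D : R * R.

Lemma segment_line_point (r g u v : R) :
  segment (line_point r g u) (line_point r g v) =
  [set w | exists2 t, (exists2 a, 0 <= a <= 1 & t = (1 - a) * u + a * v) & w = line_point r g t].
Proof.
apply/seteqP; split => w /=.
  move=> [a aI ->]; exists ((1 - a) * u + a * v); first by exists a.
  by rewrite /line_point /scale; congr (_, _) => /=; ring.
move=> [t [a aI ->] ->]; exists a => //.
by rewrite /line_point /scale; congr (_, _) => /=; ring.
Qed.

Lemma between_le0 (u v q : R) :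
  (exists2 a, 0 <= a <= 1 & q = (1 - a) * u + a * v) <-> (u - q) * (v - q) <= 0.
Proof.
split=> [[a /andP[a0 a1] ->]|h].
  rewrite (_ : _ * _ = - (a * (1 - a) * (u - v) ^+ 2)); last by ring.
  by rewrite oppr_le0 mulr_ge0 ?sqr_ge0// mulr_ge0// subr_ge0.
have [uv|uv] := eqVneq u v.
  exists 0; first by rewrite lexx ler01.
  move: h; rewrite uv -expr2 => h; have : (v - q) ^+ 2 = 0.
    by apply/eqP; rewrite eq_le h sqr_ge0.
  by move/eqP; rewrite expf_eq0/= subr_eq0 => /eqP <-; ring.
exists ((u - q) / (u - v)); last by field; rewrite subr_eq0.
have : u - v != 0 by rewrite subr_eq0.
rewrite neq_lt => /orP[uv'|uv'].
  rewrite ler_ndivlMr// ler_ndivrMr// mul0r mul1r; apply/andP; split; nra.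
by rewrite ler_pdivlMr// ler_pdivrMr// mul0r mul1r; apply/andP; split; nra.
Qed.

(** Taking the scalar product of the common point with each normal gives
    [r2 = r1 cos (g1 - g2) - t sin (g1 - g2)] and [r1 = r2 cos (g1 - g2) + t' sin (g1 - g2)], which
    determine [t] and [t']. *)
Lemma line_point_eq (g1 g2 r1 r2 t t' : R) : sin (g1 - g2) != 0 ->
  line_point r1 g1 t = line_point r2 g2 t' <->
  t = cut1 g1 g2 r1 r2 /\ t' = cut2 g1 g2 r1 r2.
Proof.
move=> s0; have e1 := cos2Dsin2 g1; have e2 := cos2Dsin2 g2.
rewrite /line_point /cut1 /cut2; split.
  move=> [h1 h2]; split; apply: (mulIf s0); rewrite divfK// sinB cosB.
    transitivity (r1 * (cos g1 * cos g2 + sin g1 * sin g2) -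
      (cos g2 * (r1 * cos g1 - t * sin g1) + sin g2 * (r1 * sin g1 + t * cos g1))).
      by ring.
    by rewrite h1 h2 -[r2 in RHS]mulr1 -e2; ring.
  transitivity ((cos g1 * (r2 * cos g2 - t' * sin g2) +
      sin g1 * (r2 * sin g2 + t' * cos g2)) -
      r2 * (cos g1 * cos g2 + sin g1 * sin g2)).
    by ring.
  by rewrite -h1 -h2 -[r1 in RHS]mulr1 -e1; ring.
move=> [-> ->]; congr (_, _); apply: (mulIf s0); apply/eqP; rewrite -subr_eq0.
  rewrite (_ : _ - _ = r1 * (sin (g1 - g2) * cos g1 - cos (g1 - g2) * sin g1 + sin g2) -
    r2 * (sin (g1 - g2) * cos g2 - sin g1 + cos (g1 - g2) * sin g2)); last by field.
  rewrite sinB cosB.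
  rewrite (_ : _ + sin g2 = sin g2 * (1 - (cos g1 ^+ 2 + sin g1 ^+ 2))); last by ring.
  rewrite (_ : _ - sin g1 + _ = - sin g1 * (1 - (cos g2 ^+ 2 + sin g2 ^+ 2))); last by ring.
  by rewrite e1 e2 subrr !mulr0 subrr.
rewrite (_ : _ - _ = r1 * (sin (g1 - g2) * sin g1 + cos (g1 - g2) * cos g1 - cos g2) -
    r2 * (sin (g1 - g2) * sin g2 + cos g1 - cos (g1 - g2) * cos g2)); last by field.
rewrite sinB cosB.
rewrite (_ : _ - cos g2 = - cos g2 * (1 - (cos g1 ^+ 2 + sin g1 ^+ 2))); last by ring.
rewrite (_ : _ + cos g1 - _ = cos g1 * (1 - (cos g2 ^+ 2 + sin g2 ^+ 2))); last by ring.
by rewrite e1 e2 subrr !mulr0 subrr.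
Qed.

Lemma meet_line_point (g1 g2 r1 r2 u v u' v' : R) : sin (g1 - g2) != 0 ->
  segment (line_point r1 g1 u) (line_point r1 g1 v) `&`
    segment (line_point r2 g2 u') (line_point r2 g2 v') !=set0 <->
  (u - cut1 g1 g2 r1 r2) * (v - cut1 g1 g2 r1 r2) <= 0 /\
  (u' - cut2 g1 g2 r1 r2) * (v' - cut2 g1 g2 r1 r2) <= 0.
Proof.
move=> s0; rewrite !segment_line_point -!between_le0; split.
  move=> [w [/= [t ta ->] [t' ta' /(line_point_eq _ _ _ _ s0)[tE tE']]]].
  by rewrite -tE -tE'.
move=> [h1 h2]; exists (line_point r1 g1 (cut1 g1 g2 r1 r2)); split => /=.
  by exists (cut1 g1 g2 r1 r2).
exists (cut2 g1 g2 r1 r2) => //; exact/line_point_eq.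
Qed.

(** The l1 distance between the point of parameter [p.1] on the first segment and that of parameter
    [p.2] on the second. Being made of absolute values of polynomials, it is measurable in the
    endpoints. *)
Definition gap A B C D (p : R * R) : R :=
  `|(1 - p.1) * A.1 + p.1 * B.1 - ((1 - p.2) * C.1 + p.2 * D.1)| +
  `|(1 - p.1) * A.2 + p.1 * B.2 - ((1 - p.2) * C.2 + p.2 * D.2)|.

(** A Lipschitz constant of [gap] in [p] for the sup norm. *)
Definition gap_lipschitz A B C D : R :=
  `|B.1 - A.1| + `|D.1 - C.1| + (`|B.2 - A.2| + `|D.2 - C.2|).

Lemma segments_meetP A B C D : segment A B `&` segment C D !=set0 <->
  exists2 p, (`[0, 1]%classic `*` `[0, 1]%classic) p & gap A B C D p = 0.
Proof.
split.
  move=> [w [/= [a aI ->] [b bI /pair_equal_spec[/= e1 e2]]]]; exists (a, b) => /=.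
    by rewrite !in_itv.
  by rewrite /gap/= e1 e2 !subrr normr0 addr0.
move=> [[a b] /= [+ +] /eqP]; rewrite !in_itv/= => aI bI.
rewrite /gap/= paddr_eq0// !normr_eq0 !subr_eq0 => /andP[/eqP e1 /eqP e2].
exists (scale (1 - a) A + scale a B); split; first by exists a.
by exists b => //; apply/pair_equal_spec.
Qed.

Lemma gap_dist A B C D (p q : R * R) (e : R) : `|p.1 - q.1| <= e -> `|p.2 - q.2| <= e ->
  gap A B C D q <= gap A B C D p + gap_lipschitz A B C D * e.
Proof.
have coord (a b c d x y x' y' : R) : `|x - x'| <= e -> `|y - y'| <= e ->
    `|(1 - x') * a + x' * b - ((1 - y') * c + y' * d)| <=
    `|(1 - x) * a + x * b - ((1 - y) * c + y * d)| + (`|b - a| + `|d - c|) * e.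
  move=> hx hy.
  rewrite (_ : (1 - x') * a + x' * b - ((1 - y') * c + y' * d) =
    (1 - x) * a + x * b - ((1 - y) * c + y * d) +
    ((x' - x) * (b - a) + (y - y') * (d - c))); last by ring.
  apply: (le_trans (ler_normD _ _)); rewrite lerD2l.
  apply: (le_trans (ler_normD _ _)); rewrite !normrM mulrDl; apply: lerD.
    by rewrite mulrC [`|x' - x|]distrC ler_wpM2l.
  by rewrite mulrC ler_wpM2l.
move=> h1 h2; rewrite /gap /gap_lipschitz [X in _ <= _ + X]mulrDl addrACA; apply: lerD; exact: coord.
Qed.

Lemma continuous_gap A B C D : continuous (gap A B C D).
Proof.
move=> p; have c1 : (fun q : R * R => q.1) @ p --> p.1 by exact: cvg_fst.
have c2 : (fun q : R * R => q.2) @ p --> p.2 by exact: cvg_snd.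
have lin (a b : R) (f : R * R -> R) : f @ p --> f p ->
    (fun q => (1 - f q) * a + f q * b) @ p --> (1 - f p) * a + f p * b.
  move=> cf; apply: cvgD; apply: cvgM => //; try exact: cvg_cst.
  by apply: cvgB => //; exact: cvg_cst.
by apply: cvgD; apply: cvg_norm; apply: cvgB; exact: lin.
Qed.

(* By compactness, the existence of a common point becomes a countable
   condition on the endpoints, hence a Borel one. *)
Lemma segments_meet_grid A B C D : segment A B `&` segment C D !=set0 <->
  forall n : nat, exists i j : nat, [/\ (i <= n.+1)%N, (j <= n.+1)%N &
    gap A B C D (i%:R / n.+1%:R, j%:R / n.+1%:R) <= gap_lipschitz A B C D / n.+1%:R].
Proof.
rewrite segments_meetP; split.
  move=> [[a b] /= [+ +] g0] n; rewrite !in_itv/= => /andP[a0 a1] /andP[b0 b1].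
  have n0 : 0 < n.+1%:R :> R by rewrite ltr0n.
  have near (x : R) : 0 <= x -> x <= 1 -> exists2 i : nat, (i <= n.+1)%N &
      `|x - i%:R / n.+1%:R| <= n.+1%:R^-1.
    (* The left grid neighbour of [x]; the index [n.+1] is reached at [x = 1]. *)
    move=> x0 x1; exists (Num.truncn (x * n.+1%:R)).
      rewrite -(@ler_nat R); apply: (@le_trans _ _ (x * n.+1%:R)).
        by rewrite truncn_le mulr_ge0// ltW.
      by rewrite ler_piMl// ltW.
    have /truncn_itv/andP[h1 h2] : 0 <= x * n.+1%:R by rewrite mulr_ge0// ltW.
    rewrite ler_norml; apply/andP; split.
      apply: (@le_trans _ _ 0); first by rewrite oppr_le0 invr_ge0 ltW.
      by rewrite subr_ge0 ler_pdivrMr.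
    by rewrite lerBlDr -[X in X + _]mul1r -mulrDl ler_pdivlMr// addrC natr1 ltW.
  have [i i1 hi] := near a a0 a1; have [j j1 hj] := near b b0 b1.
  exists i, j; split => //.
  by have := @gap_dist A B C D (a, b) (i%:R / n.+1%:R, j%:R / n.+1%:R) _ hi hj; rewrite g0 add0r.
move=> grid; set K := (`[0, 1]%classic `*` `[0, 1]%classic : set (R * R)).
have cK : compact K by apply: compact_setX; exact: segment_compact.
have cI : closed (gap A B C D @` K).
  apply: compact_closed => //; apply: continuous_compact => //.
  by apply: continuous_subspaceT => x; exact: continuous_gap.
(* The image of the compact square is closed, so it is enough to find values of [gap] arbitrarily
   close to [0]; the grid provides them. *)
suff : closure (gap A B C D @` K) 0 by move/cI => [p Kp g0]; exists p.
move=> U /nbhs_ballP[e /= e0 eU].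
have [n ne] : exists n : nat, gap_lipschitz A B C D / n.+1%:R < e.
  have M0 : 0 <= gap_lipschitz A B C D by rewrite !addr_ge0.
  exists (Num.truncn (gap_lipschitz A B C D / e)).
  rewrite ltr_pdivrMr ?ltr0n// mulrC -ltr_pdivrMr//.
  by rewrite truncnS_gt.
have [i [j [i1 j1 g]]] := grid n.
exists (gap A B C D (i%:R / n.+1%:R, j%:R / n.+1%:R)); split.
  exists (i%:R / n.+1%:R, j%:R / n.+1%:R) => //; split; rewrite /= in_itv/=.
    by rewrite divr_ge0//= ler_pdivrMr ?ltr0n// mul1r ler_nat.
  by rewrite divr_ge0//= ler_pdivrMr ?ltr0n// mul1r ler_nat.
apply: eU; rewrite /ball/= sub0r normrN ger0_norm; first exact: le_lt_trans g ne.
by rewrite addr_ge0.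
Qed.

Lemma measurable_segments_meet d (T : measurableType d) (a1 a2 a3 a4 : T -> L * L) :
    measurable_fun setT a1 -> measurable_fun setT a2 ->
    measurable_fun setT a3 -> measurable_fun setT a4 ->
  measurable_fun setT
    (fun x => `[< segment (a1 x) (a2 x) `&` segment (a3 x) (a4 x) !=set0 >]).
Proof.
move=> m1 m2 m3 m4; apply: (measurable_fun_bool true); rewrite setTI.
pose E n i j := [set x | gap (a1 x) (a2 x) (a3 x) (a4 x) (i%:R / n.+1%:R, j%:R / n.+1%:R) <=
  gap_lipschitz (a1 x) (a2 x) (a3 x) (a4 x) / n.+1%:R].
rewrite (_ : _ @^-1` _ = \bigcap_n \bigcup_(i in [set i | (i <= n.+1)%N])
    \bigcup_(j in [set j | (j <= n.+1)%N]) E n i j).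
  apply: bigcapT_measurable => n; apply: bigcup_measurable => i _.
  apply: bigcup_measurable => j _; rewrite (_ : E n i j = (fun x =>
    gap (a1 x) (a2 x) (a3 x) (a4 x) (i%:R / n.+1%:R, j%:R / n.+1%:R) <=
    gap_lipschitz (a1 x) (a2 x) (a3 x) (a4 x) / n.+1%:R) @^-1` [set true])//.
  rewrite -[X in measurable X]setTI; apply: (_ : measurable_fun _ _) => //.
  by rewrite /gap /gap_lipschitz /=; meas.
apply/seteqP; split => x /=.
  move=> /asboolP/segments_meet_grid h n _.
  by have [i [j [i1 j1 g]]] := h n; exists i => //; exists j.
move=> h; apply/asboolP/segments_meet_grid => n.
by have [i i1 [j j1 g]] := h n Logic.I; exists i, j.
Qed.

End meeting_segments.

(** * Measurable sets inside and around a set of finite outer measure *)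

Section outer_approximation.
Context d (T : measurableType d) (R : realType) (m : {measure set T -> \bar R}).
Local Notation mo := (m^*)%mu.
Local Open Scope ereal_scope.

Lemma outer_measurable_split (X E : set T) : measurable E ->
  mo X = mo (X `&` E) + mo (X `&` ~` E).
Proof.
move=> mE; have /(_ E) := @sub_caratheodory _ _ _ m.
apply; exact: sub_gen_smallest.
Qed.

(** Intersection over [n] of countable covers whose total measure is below [mo X + 1 / (n + 1)]. *)
Lemma measurable_hull (X : set T) : mo X < +oo ->
  exists G, [/\ measurable G, X `<=` G & m G = mo X].
Proof.
move=> Xoo; have Xfin : mo X \is a fin_num by rewrite ge0_fin_numE// mu_ext_ge0.
have cover n : exists F : (set T)^nat, measurable_cover X F /\
    \sum_(0 <= k <oo) m (F k) < mo X + (n.+1%:R^-1)%:E.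
  have n0 : (0 < n.+1%:R^-1 :> R)%R by rewrite invr_gt0.
  by have [_ [F XF <-] h] := lb_ereal_inf_adherent n0 Xfin; exists F.
have [F FP] := choice cover.
have mF n k : measurable (F n k) by have [[]] := FP n.
pose G := \bigcap_n \bigcup_k F n k.
have mG : measurable G by apply: bigcapT_measurable => n; exact: bigcupT_measurable.
have XG : X `<=` G by move=> x Xx n _; have [[_ /(_ x Xx)]] := FP n.
exists G; split => //; apply/eqP; rewrite eq_le; apply/andP; split; last first.
  by rewrite -measurable_mu_extE//; exact: le_mu_ext.
apply/lee_addgt0Pr => e e0.
near \oo => n.
apply: (@le_trans _ _ (\sum_(0 <= k <oo) m (F n k))).
  apply: (@le_trans _ _ (m (\bigcup_k F n k))).
    by apply: le_measure; rewrite ?inE//; [exact: bigcupT_measurable|exact: bigcap_inf].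
  apply: measure_sigma_subadditive => //; exact: bigcupT_measurable.
have [_ /ltW h] := FP n; apply: (le_trans h); rewrite leeD2l// lee_fin ltW//.
by near: n; exact: near_infty_natSinv_lt (PosNum e0).
Unshelve. all: by end_near. Qed.

(** [E] and its complement cut [X] and [G] into two pieces each. The inclusion orders both pairs of
    pieces the same way, and the totals are equal and finite, so the pieces have equal measures. *)
Lemma outer_measure_setI (X G E : set T) : measurable G -> measurable E ->
    mo X < +oo -> m G = mo X -> (X `<=` G \/ G `<=` X) ->
  mo (E `&` X) = m (E `&` G).
Proof.
move=> mG mE Xoo GX XG.
have Xs := outer_measurable_split X mE.
have Gs := outer_measurable_split G mE.
rewrite -measurable_mu_extE; last exact: measurableI.
rewrite ![E `&` _]setIC.
have GX' : mo G = mo X by rewrite measurable_mu_extE.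
have fin A : A `<=` X \/ A `<=` G -> mo A \is a fin_num.
  move=> h; rewrite ge0_fin_numE ?mu_ext_ge0//; apply: le_lt_trans Xoo.
  by case: h => h; [|rewrite -GX']; exact: le_mu_ext.
have key : mo (X `&` E) + mo (X `&` ~` E) = mo (G `&` E) + mo (G `&` ~` E).
  by rewrite -Xs -Gs.
have f1 := fin (X `&` E) (or_introl (@subIsetl _ _ _)).
have f2 := fin (X `&` ~` E) (or_introl (@subIsetl _ _ _)).
have f3 := fin (G `&` E) (or_intror (@subIsetl _ _ _)).
have f4 := fin (G `&` ~` E) (or_intror (@subIsetl _ _ _)).
have le : (mo (X `&` E) <= mo (G `&` E) /\ mo (X `&` ~` E) <= mo (G `&` ~` E)) \/
  (mo (G `&` E) <= mo (X `&` E) /\ mo (G `&` ~` E) <= mo (X `&` ~` E)).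
  by case: XG => h; [left|right]; split; apply: le_mu_ext; exact: setSI.
move: key le; rewrite -(fineK f1) -(fineK f2) -(fineK f3) -(fineK f4) -!EFinD.
by rewrite !lee_fin => -[key] [] [h1 h2]; congr EFin; lra.
Qed.

(** Remove from [B] a hull of the part of [B] outside [X]. Caratheodory's condition for [X], tested
    on [B], shows that what is left has the measure of [X]. *)
Lemma measurable_core (X B : set T) : mo.-caratheodory X -> measurable B ->
    X `<=` B -> m B < +oo ->
  exists G, [/\ measurable G, G `<=` X & m G = mo X].
Proof.
move=> cX mB XB Boo.
have BXoo : mo (B `\` X) < +oo.
  by apply: le_lt_trans Boo; rewrite -measurable_mu_extE//; exact: le_mu_ext.
have [H [mH BXH mHE]] := measurable_hull BXoo.
exists (B `\` H); split; first exact: measurableD.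
  by move=> x [Bx Hx]; apply: contrapT => nX; apply: Hx; exact: BXH.
have mHB : m (B `&` H) = mo (B `\` X).
  apply/eqP; rewrite eq_le; apply/andP; split.
    rewrite -mHE; apply: le_measure; rewrite ?inE//; exact: measurableI.
  rewrite -measurable_mu_extE; last exact: measurableI.
  by apply: le_mu_ext => x [Bx nX]; split => //; exact: BXH.
have := cX B; rewrite measurable_mu_extE// setIidr// -setDE -mHB => BE.
transitivity (m B - m (B `&` H)); first exact: measureD.
rewrite (_ : m B = mo X + m (B `&` H)); last exact: BE.
rewrite addeK// ge0_fin_numE//; apply: le_lt_trans Boo; apply: le_measure; rewrite ?inE//.
exact: measurableI.
Qed.

End outer_approximation.

(** * Polar coordinates, radial function and chords *)

Section polar_coordinates.
Variable R : realType.

(** The angle [acos (b / n)], with [n] the norm, taken with the sign of [a] is a witness, so [xget]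
    does not return its default. *)
Lemma atan2P (a b : R) : (a != 0) || (b != 0) ->
  (cos (atan2 a b), sin (atan2 a b)) = scale (Num.sqrt (a ^+ 2 + b ^+ 2))^-1 (b, a).
Proof.
move=> ab0; have n0 : 0 < a ^+ 2 + b ^+ 2.
  rewrite lt_neqAle eq_sym addr_ge0 ?sqr_ge0// andbT paddr_eq0 ?sqr_ge0//.
  by rewrite !sqrf_eq0 negb_and.
suff : exists t, - pi < t <= pi /\
    (cos t, sin t) = scale (Num.sqrt (a ^+ 2 + b ^+ 2))^-1 (b, a).
  by move=> /(xgetPex 0) [].
set n := Num.sqrt _; have n1 : 0 < n by rewrite sqrtr_gt0.
set x := n^-1 * b; set y := n^-1 * a.
have nn : n ^+ 2 = a ^+ 2 + b ^+ 2 by rewrite sqr_sqrtr// ltW.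
have xy : x ^+ 2 + y ^+ 2 = 1.
  by rewrite /x /y !exprMn -mulrDr addrC -nn exprVn mulVf// expf_neq0// gt_eqF.
have x1 : -1 <= x <= 1 by have := sqr_ge0 y => y0; apply/andP; split; nra.
have pi0 := @pi_gt0 R.
have sE : sin (acos x) = `|y|.
  by rewrite sin_acos// (_ : 1 - x ^+ 2 = y ^+ 2) ?sqrtr_sqr// -xy; ring.
have cE : cos (acos x) = x by rewrite acosK// in_itv.
have a0 := acos_ge0 x1; have a1 := acos_lepi x1.
rewrite /scale/= -/x -/y; have [y0|y0] := leP 0 y.
  exists (acos x); split; first by apply/andP; split; lra.
  by rewrite sE cE ger0_norm.
exists (- acos x); split; last first.
  by rewrite sinN cosN sE cE ltr0_norm// opprK.
(* The value [- pi] is not allowed; it would force [y = 0]. *)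
have : acos x != pi.
  apply/eqP => axpi; move: sE; rewrite axpi sinpi => /esym/eqP.
  by rewrite normr_eq0 => /eqP y00; rewrite y00 ltxx in y0.
by rewrite neq_lt => /orP[h|h]; apply/andP; split; lra.
Qed.

(** Passage to the polar form in which [chord] is written. At the origin the modulus is [0], and the
    default value of [atan2] is harmless. *)
Lemma line_point_polar (r g t : R) :
  line_point r g t = scale (Num.sqrt (r ^+ 2 + t ^+ 2)) (unit_vec (g + atan2 t r)).
Proof.
have [/andP[/eqP-> /eqP->]|] := boolP ((t == 0) && (r == 0)).
  by rewrite /line_point /scale expr0n/= addr0 sqrtr0 !mul0r subrr addr0.
rewrite negb_and => tr0; have := atan2P tr0; rewrite addrC /scale/= => -[cE sE].
set n := Num.sqrt (r ^+ 2 + t ^+ 2) in cE sE *.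
have n0 : n != 0.
  rewrite sqrtr_eq0 -ltNge lt_neqAle eq_sym addr_ge0 ?sqr_ge0// andbT.
  by rewrite paddr_eq0 ?sqr_ge0// !sqrf_eq0 negb_and orbC.
by rewrite /unit_vec/= cosD sinD cE sE /line_point; congr (_, _); field.
Qed.

End polar_coordinates.

Section star_shaped_sets.
Variables (R : realType) (Omega : set (R * R)).
Hypotheses (Omega_bounded : bounded_set Omega) (Omega_0 : Omega (0, 0))
  (Omega_star : star_shaped Omega).

Lemma bounded_coord : exists2 M : R, 0 < M &
  forall x, Omega x -> `|x.1| <= M /\ `|x.2| <= M.
Proof.
have [M M0 MP] := ex_strict_bound_gt0 Omega_bounded.
exists M => // x /MP /=; rewrite prod_normE gt_max => /andP[h1 h2].
by split; exact: ltW.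
Qed.

Lemma radial_has_sup (phi : R) :
  has_sup [set s | 0 <= s /\ Omega (scale s (unit_vec phi))].
Proof.
split; first by exists 0; split => //; rewrite /scale !mul0r.
(* [s = s cos^2 + s sin^2], and each term is at most the absolute value of a coordinate of the
   point, hence [M + M]. *)
have [M M0 MP] := bounded_coord; exists (M + M) => s [s0 /MP /= [h1 h2]].
rewrite -(ger0_norm s0) -[leLHS]mulr1 -(@normr1 R) -(cos2Dsin2 phi).
rewrite -normrM mulrDr; apply: (le_trans (ler_normD _ _)); apply: lerD.
  rewrite expr2 mulrA normrM; apply: (le_trans _ h1).
  by rewrite ler_piMr// ler_norml cos_geN1 cos_le1.
rewrite expr2 mulrA normrM; apply: (le_trans _ h2).
by rewrite ler_piMr// ler_norml sin_geN1 sin_le1.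
Qed.

Lemma radial_ge0 (phi : R) : 0 <= radial Omega phi.
Proof.
apply: sup_upper_bound; first exact: radial_has_sup.
by split => //; rewrite /scale !mul0r.
Qed.

Lemma line_point_chord (r g t : R) : Omega (line_point r g t) -> chord Omega r g t.
Proof.
rewrite line_point_polar => h; rewrite /chord/=.
have n0 : 0 <= r ^+ 2 + t ^+ 2 by rewrite addr_ge0// sqr_ge0.
rewrite -[leLHS](sqr_sqrtr n0) ler_pXn2r ?nnegrE ?sqrtr_ge0 ?radial_ge0//.
by apply: sup_upper_bound; [exact: radial_has_sup|split; rewrite ?sqrtr_ge0].
Qed.

(** The radial supremum may not be attained, so an endpoint of the chord can lie outside [Omega].
    Strictly below it, some point of [Omega] lies further out on the ray, and star-shapedness brings
    it back. *)
Lemma chord_line_point (r g t k : R) : chord Omega r g t -> 0 <= k < 1 ->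
  Omega (scale k (line_point r g t)).
Proof.
rewrite /chord/= => h /andP[k0 k1]; rewrite line_point_polar.
have n0 : 0 <= r ^+ 2 + t ^+ 2 by rewrite addr_ge0// sqr_ge0.
move: h; rewrite -[leLHS](sqr_sqrtr n0) ler_pXn2r ?nnegrE ?sqrtr_ge0 ?radial_ge0//.
set s := Num.sqrt _; set phi := g + _ => h.
have s0 : 0 <= s by rewrite sqrtr_ge0.
have scaleM a b (x : R * R) : scale a (scale b x) = scale (a * b) x.
  by rewrite /scale/= !mulrA.
have [->|sn0] := eqVneq s 0; first by rewrite /scale !mul0r !mulr0.
have sp : 0 < s by rewrite lt_neqAle eq_sym sn0.
have ks : k * s < radial Omega phi by apply: lt_le_trans h; rewrite gtr_pMl.
have e0 : 0 < radial Omega phi - k * s by rewrite subr_gt0.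
have [s' [s'0 Os']] := sup_adherent e0 (radial_has_sup phi).
rewrite -/(radial _ _) subKr => ks'.
have s'p : 0 < s' by apply: le_lt_trans ks'; rewrite mulr_ge0.
rewrite scaleM -(divfK (lt0r_neq0 s'p) (k * s)) -scaleM; apply: Omega_star => //.
by rewrite divr_ge0 ?mulr_ge0//= ler_pdivrMr// mul1r ltW.
Qed.

(** [r] is the scalar product of the point with the normal. Stopping the range of [r] at the support
    function thus drops only lines that miss [Omega]. *)
Lemma chord_le_support (r g t : R) : Omega (line_point r g t) -> r <= support_fun Omega g.
Proof.
move=> h; have E : dot (line_point r g t) (unit_vec g) = r.
  rewrite /dot /line_point/= -[RHS]mulr1 -(cos2Dsin2 g); ring.
rewrite -{1}E; apply: sup_upper_bound; last by exists (line_point r g t).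
split; first by exists (dot (line_point r g t) (unit_vec g)), (line_point r g t).
have [M M0 MP] := bounded_coord; exists (M + M) => _ [x /MP[h1 h2] <-].
rewrite /dot; apply: lerD; rewrite (le_trans (ler_norm _))// normrM.
  by rewrite (le_trans _ h1)// ler_piMr// ler_norml cos_geN1 cos_le1.
by rewrite (le_trans _ h2)// ler_piMr// ler_norml sin_geN1 sin_le1.
Qed.

End star_shaped_sets.

(** * Borel approximations of [Omega] from inside and outside *)

Section plane_approximation.
Variables (R : realType) (Omega : set (R * R)).
Local Notation L := (measurableTypeR R).
Local Notation mu := (@lebesgue_measure R).
Local Notation mu2 := (@plane_measure R).
Hypotheses (Omega_bounded : bounded_set Omega) (Omega_0 : Omega (0, 0))
  (Omega_star : star_shaped Omega).
Local Open Scope ereal_scope.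

Lemma bounded_box : exists B : set (L * L),
  [/\ measurable B, Omega `<=` B & mu2 B < +oo].
Proof.
have [M M0 MP] := bounded_coord Omega_bounded.
exists (`[(- M)%R, M]%classic `*` `[(- M)%R, M]%classic); split.
- by apply: measurableX; exact: measurable_itv.
- by move=> x /MP[h1 h2]; split; rewrite /= in_itv/= -ler_norml.
- rewrite /plane_measure product_measure1E; try exact: measurable_itv.
  rewrite /= lebesgue_measure_itv/=; case: ifPn => _; last by rewrite mule0 ltry.
  by rewrite -EFinB -EFinM ltry.
Qed.

Lemma area_lty : area Omega < +oo.
Proof.
have [B [mB OB Boo]] := bounded_box; apply: le_lt_trans Boo.
by rewrite -[leRHS]measurable_mu_extE//; exact: le_mu_ext.
Qed.

Lemma measurable_scale_preimage (G : set (L * L)) (k : R) : measurable G ->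
  measurable [set z : L * L | G (scale k z)].
Proof.
move=> mG; rewrite -[X in measurable X]setTI.
have ms : measurable_fun setT (fun z : L * L => scale k z : L * L).
  by rewrite /scale; meas.
exact: ms.
Qed.

Lemma plane_measure_scale (G : set (L * L)) (k : R) : (0 < k)%R -> measurable G ->
  mu2 G = (k ^+ 2)%:E * mu2 [set z | G (scale k z)].
Proof.
move=> k0 mG; have mGk := measurable_scale_preimage k mG.
rewrite -[in LHS](setIT G) -(integral_indic mu2 measurableT mG).
rewrite -[in RHS](setIT [set z | _]) -(integral_indic mu2 measurableT mGk).
rewrite (@integral_scale_shift2 _ k 0%R (fun z => (\1_G z)%:E)).
- rewrite ger0_norm ?ltW//; congr (_ * _); apply: eq_integral => z _.
  by rewrite !indicE !addr0.
- by rewrite gt_eqF.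
- by apply/measurable_EFinP; exact: measurable_indic.
- by move=> p; rewrite lee_fin.
Qed.

(** The equality for every Borel [E], and not just for the total area, is what transfers the uniform
    law from [Omega] to [G]. *)
Lemma inner_plane_set : lebesgue_measurable_plane Omega -> exists G : set (L * L),
  [/\ measurable G, G `<=` Omega & forall E : set (L * L), measurable E ->
     area (E `&` Omega) = mu2 (E `&` G)].
Proof.
move=> mO; have [B [mB OB Boo]] := bounded_box.
have [G [mG GO GE]] := @measurable_core _ _ _ mu2 _ _ mO mB OB Boo.
exists G; split => // E mE; apply: outer_measure_setI => //; last by right.
exact: area_lty.
Qed.

(* [G] intersects dilates, by factors tending to [1], of a Borel hull of [Omega]:
   it thereby contains the closed radial chords, which may leave [Omega] at their
   endpoints and need not be measurable, at no cost in area. *)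
Lemma outer_plane_set : exists G : set (L * L),
  [/\ measurable G, forall r g t, chord Omega r g t -> G (line_point r g t) &
    forall E : set (L * L), measurable E -> area (E `&` Omega) = mu2 (E `&` G)].
Proof.
have [H [mH OH HE]] := @measurable_hull _ _ _ mu2 _ area_lty.
(* Starting at [n + 2] keeps the factors positive: [k 0 = 1 / 2]. *)
pose k n : R := (1 - n.+2%:R^-1)%R.
have n1 n : (0 < (n.+2%:R^-1 : R) < 1)%R.
  by rewrite invr_gt0 ltr0n/= invf_lt1 ?ltr0n// ltr1n.
have k0 n : (0 < k n < 1)%R.
  by have := n1 n; rewrite /k; set i := (n.+2%:R^-1)%R; move: i => i /andP[? ?]; apply/andP; split; lra.
pose Hk n := [set z : L * L | H (scale (k n) z)].
have mHk n : measurable (Hk n) by exact: measurable_scale_preimage.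
pose G := \bigcap_n Hk n.
have mG : measurable G by exact: bigcapT_measurable.
have chordG r g t : chord Omega r g t -> G (line_point r g t).
  move=> h n _; apply: OH; apply: chord_line_point h _ => //.
  by have /andP[/ltW -> ->] := k0 n.
have OG : Omega `<=` G.
  move=> z Oz n _; apply: OH; apply: Omega_star => //.
  by have /andP[/ltW -> /ltW ->] := k0 n.
have Hfin : mu2 H \is a fin_num by rewrite ge0_fin_numE// HE; exact: area_lty.
(* [G] lies in [Hk n], whose area is that of [H] divided by [k n ^+ 2]. *)
have Gle n : mu2 G * (k n ^+ 2)%:E <= mu2 H.
  have /andP[kn0 _] := k0 n; rewrite (plane_measure_scale kn0 mH) muleC.
  apply: lee_wpmul2l; first by rewrite lee_fin sqr_ge0.
  by apply: le_measure; rewrite ?inE//; [exact: mHk|move=> z; apply].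
have GH : mu2 G = area Omega.
  apply/eqP; rewrite eq_le; apply/andP; split; last first.
    by rewrite -[leRHS]measurable_mu_extE//; exact: le_mu_ext.
  have Gfin : mu2 G \is a fin_num.
    rewrite ge0_fin_numE//; have := Gle 0%N; have /andP[kn0 _] := k0 0%N.
    move=> h; have : mu2 G * (k 0%N ^+ 2)%:E < +oo by apply: le_lt_trans h _; rewrite -ge0_fin_numE.
    case: (mu2 G) => [z _|h'|_]; [exact: ltry| |by rewrite ltNye].
    by move: h'; rewrite gt0_mulye ?ltxx// lte_fin exprn_gt0.
  have [x GE] : exists x, mu2 G = x%:E by exists (fine (mu2 G)); rewrite fineK.
  have [y HyE] : exists y, mu2 H = y%:E by exists (fine (mu2 H)); rewrite fineK.
  have x0 : (0 <= x)%R by rewrite -lee_fin -GE.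
  rewrite GE (_ : area Omega = y%:E); last by rewrite -HyE HE.
  rewrite lee_fin.
  apply/ler_addgt0Pr => e e0.
  (* With [i = 1 / (n + 2)], the inequality [(1 - i)^2 >= 1 - 2 i] bounds the excess of area by
     [2 x i], which this [n] makes at most [e]. *)
  pose n := Num.truncn (2 * x / e).
  have := Gle n; rewrite GE HyE -EFinM lee_fin => h.
  have hn : (2 * x / n.+2%:R <= e)%R.
    rewrite ler_pdivrMr ?ltr0n// [(e * _)%R]mulrC -ler_pdivrMr// ltW//.
    by apply: (lt_le_trans (truncnS_gt _)); rewrite ler_nat.
  move: h hn; rewrite /k; set i := (n.+2%:R^-1)%R; have /andP[i0 i1] : (0 < i < 1)%R by exact: n1.
  move=> h hn; have : (0 <= x * i ^+ 2)%R by rewrite mulr_ge0// sqr_ge0.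
  by nra.
exists G; split => // E mE; apply: outer_measure_setI => //; last by left.
exact: area_lty.
Qed.

End plane_approximation.

(** * Joint laws of independent points *)

Section pair_law.
Context d (T : measurableType d) (R : realType) (P : probability T R).
Context d1 d2 (U : measurableType d1) (V : measurableType d2).
Variables (X : {RV P >-> U}) (Y : {RV P >-> V}).
Local Open Scope ereal_scope.

Definition pair_RV (w : T) : (U * V)%type := (X w, Y w).

Lemma measurable_pair_RV : measurable_fun setT pair_RV.
Proof. by apply: measurable_fun_pair; exact: measurable_funPT. Qed.

HB.instance Definition _ := isMeasurableFun.Build _ _ _ _ pair_RV measurable_pair_RV.

(** When [P H > 0], the conditional law of the pair given [H] agrees with the product measure on
    rectangles, hence everywhere. Keeping an event [H] lets independence be extended to one pair at
    a time. *)
Lemma law_pair_given (H : set T) : measurable H ->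
    (forall E F, measurable E -> measurable F ->
      P (H `&` (X @^-1` E `&` Y @^-1` F)) = P H * (P (X @^-1` E) * P (Y @^-1` F))) ->
  forall S, measurable S ->
    P (H `&` pair_RV @^-1` S) = P H * (distribution P X \x distribution P Y) S.
Proof.
move=> mH indep S mS.
have mpre (S' : set (U * V)) : measurable S' -> measurable (pair_RV @^-1` S').
  by move=> mS'; rewrite -[X in measurable X]setTI; exact: measurable_pair_RV.
have PH : P H \is a fin_num by exact: fin_num_measure.
have [PH0|PHn0] := eqVneq (P H) 0.
  rewrite PH0 mul0e; apply/eqP; rewrite eq_le measure_ge0 andbT -PH0.
  by apply: le_measure; rewrite ?inE//; apply: measurableI => //; exact: mpre.
pose p := fine (P H).
have pE : P H = p%:E by rewrite fineK.
have p0 : (p != 0)%R by apply: contra_neq PHn0 => p0; rewrite pE p0.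
have p1 : (0 <= p^-1)%R by rewrite invr_ge0 fine_ge0.
pose nu : {measure set (U * V) -> \bar R} := mscale (NngNum p1)
  (measure_function_pushforward__canonical__measure_function_Measure
    (mrestr P mH) measurable_pair_RV).
rewrite (@product_measure_unique _ _ _ _ _ _ _ nu)//; last first.
  move=> E F mE mF.
  transitivity (p^-1%:E * P (pair_RV @^-1` (E `*` F) `&` H)); first by [].
  rewrite setIC (_ : pair_RV @^-1` (E `*` F) = X @^-1` E `&` Y @^-1` F)//.
  by rewrite indep// pE muleA -EFinM mulVf// mul1e.
transitivity (p%:E * (p^-1%:E * P (pair_RV @^-1` S `&` H))).
  by rewrite muleA -EFinM divff// mul1e setIC.
by rewrite pE.
Qed.

Lemma law_pair : (forall E F, measurable E -> measurable F ->
    P (X @^-1` E `&` Y @^-1` F) = P (X @^-1` E) * P (Y @^-1` F)) ->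
  forall S, measurable S ->
    distribution P pair_RV S = (distribution P X \x distribution P Y) S.
Proof.
move=> indep S mS; rewrite /distribution /= /pushforward.
have := @law_pair_given setT measurableT _ S mS.
rewrite setTI probability_setT mul1e; apply => E F mE mF.
by rewrite setTI mul1e indep.
Qed.

End pair_law.

Section four_points.
Context d (T : measurableType d) (R : realType) (P : probability T R).
Local Notation L := (measurableTypeR R).
Local Notation mu2 := (@plane_measure R).
Variables (A B C D : {RV P >-> (L * L)%type}) (G : set (L * L)) (a : R).
Hypotheses (a0 : (0 < a)%R) (mG : measurable G).
Local Open Scope ereal_scope.
Hypothesis indep : forall E1 E2 E3 E4 : set (L * L), measurable E1 -> measurable E2 ->
  measurable E3 -> measurable E4 ->
  P (A @^-1` E1 `&` B @^-1` E2 `&` (C @^-1` E3 `&` D @^-1` E4)) =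
  P (A @^-1` E1) * P (B @^-1` E2) * (P (C @^-1` E3) * P (D @^-1` E4)).
(** The uniform law of [Omega], of area [a], rewritten on a Borel set. *)
Definition scaled_law (X : {RV P >-> (L * L)%type}) :=
  forall E : set (L * L), measurable E -> P (X @^-1` E) = (a^-1)%:E * mu2 (E `&` G).
Hypotheses (lA : scaled_law A) (lB : scaled_law B) (lC : scaled_law C) (lD : scaled_law D).

Lemma integral_scaled_law (X : {RV P >-> (L * L)%type}) (f : L * L -> \bar R) :
    scaled_law X -> measurable_fun setT f -> (forall x, 0 <= f x) ->
  \int[distribution P X]_x f x = (a^-1)%:E * \int[mu2]_x ((x \in G)%:R%:E * f x).
Proof.
move=> lX mf f0; have a1 : (0 <= a^-1)%R by rewrite invr_ge0 ltW.
pose m : {measure set (L * L) -> \bar R} := mrestr mu2 mG.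
transitivity (\int[mscale (NngNum a1) m]_x f x).
  by apply: eq_measure_integral => E mE _; rewrite /= /mscale /m /mrestr/= -lX.
transitivity ((a^-1)%:E * \int[m]_x f x).
  exact: (@ge0_integral_mscale _ _ _ m setT measurableT (NngNum a1) f mf (fun x _ => f0 x)).
apply: (congr1 (fun z => (a^-1)%:E * z)).
transitivity (\int[mu2]_(x in G) f x); first exact: (@ge0_integral_mrestr _ _ _ mu2 _ mG _ mf f0).
rewrite integral_mkcond; apply: eq_integral => x _; rewrite patchE.
by case: ifPn; rewrite ?mul1e ?mul0e.
Qed.

Lemma integral_pair_law (X Y : {RV P >-> (L * L)%type}) (f : L * L -> L * L -> \bar R) :
    (forall E F, measurable E -> measurable F ->
      P (X @^-1` E `&` Y @^-1` F) = P (X @^-1` E) * P (Y @^-1` F)) ->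
    scaled_law X -> scaled_law Y ->
    measurable_fun setT (fun p => f p.1 p.2) -> (forall x y, 0 <= f x y) ->
  \int[distribution P (pair_RV X Y)]_p f p.1 p.2 =
  (a^-1 ^+ 2)%:E * \int[mu2]_x \int[mu2]_y
     ((x \in G)%:R%:E * ((y \in G)%:R%:E * f x y)).
Proof.
move=> XY lX lY mf f0.
have mGb := measurable_mem_set mG.
have mGc d' (T' : measurableType d') (g : T' -> L * L) : measurable_fun setT g ->
    measurable_fun setT (fun x => (g x \in G)).
  by move=> mg; exact: (measurableT_comp mGb mg).
have mfc d' (T' : measurableType d') (g h : T' -> L * L) : measurable_fun setT g ->
  measurable_fun setT h -> measurable_fun setT (fun p => f (g p) (h p)).
  by move=> mg mh; exact: (measurableT_comp mf (measurable_fun_pair mg mh)).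
rewrite (eq_measure_integral (distribution P X \x distribution P Y)); last first.
  by move=> S mS _; exact: law_pair.
rewrite integral_prod//.
transitivity (\int[distribution P X]_x ((a^-1)%:E * \int[mu2]_y ((y \in G)%:R%:E * f x y))).
  apply: eq_integral => x _; rewrite (integral_scaled_law lY)//.
  by meas.
rewrite ge0_integralZl//; last 3 first.
- by meas.
- by nonneg.
- by rewrite lee_fin invr_ge0 ltW.
rewrite (integral_scaled_law lX); last 2 first.
- by meas.
- by nonneg.
rewrite muleA -EFinM -expr2; congr (_ * _).
apply: eq_integral => x _; rewrite -ge0_integralZl//.
- by meas.
- by nonneg.
Qed.

(** Two extensions from rectangles: first in [(C, D)], given a rectangle event of [(A, B)], then in
    [(A, B)], given any event of [(C, D)]. *)
Lemma indep_pairs (S1 S2 : set ((L * L) * (L * L))) : measurable S1 -> measurable S2 ->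
  P (pair_RV A B @^-1` S1 `&` pair_RV C D @^-1` S2) =
  P (pair_RV A B @^-1` S1) * P (pair_RV C D @^-1` S2).
Proof.
move=> mS1 mS2.
have mX (X : {RV P >-> (L * L)%type}) E : measurable E -> measurable (X @^-1` E).
  by move=> mE; exact: measurable_funPTI.
have mXY (X Y : {RV P >-> (L * L)%type}) S : measurable S -> measurable (pair_RV X Y @^-1` S).
  by move=> mS; rewrite -[X in measurable X]setTI; exact: measurable_pair_RV.
have AB E F : measurable E -> measurable F ->
    P (A @^-1` E `&` B @^-1` F) = P (A @^-1` E) * P (B @^-1` F).
  move=> mE mF; have := indep mE mF measurableT measurableT.
  by rewrite !preimage_setT !setIT !probability_setT !mule1.
have CD E F : measurable E -> measurable F ->
    P (C @^-1` E `&` D @^-1` F) = P (C @^-1` E) * P (D @^-1` F).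
  move=> mE mF; have := indep measurableT measurableT mE mF.
  by rewrite !preimage_setT !setTI !probability_setT !mul1e.
have E1 E F : measurable E -> measurable F ->
    P (A @^-1` E `&` B @^-1` F `&` pair_RV C D @^-1` S2) =
    P (A @^-1` E) * P (B @^-1` F) * P (pair_RV C D @^-1` S2).
  move=> mE mF; rewrite (@law_pair_given _ _ _ _ _ _ _ _ C D) //; last 2 first.
  - by apply: measurableI; exact: mX.
  - by move=> E' F' mE' mF'; rewrite indep// AB.
  rewrite AB//; apply: (congr1 (fun z => _ * z)).
  by rewrite -(@law_pair _ _ _ _ _ _ _ _ C D).
rewrite setIC (@law_pair_given _ _ _ _ _ _ _ _ A B)//; last 2 first.
- exact: mXY.
- by move=> E F mE mF; rewrite setIC E1// muleC.
by rewrite -(@law_pair _ _ _ _ _ _ _ _ A B)// muleC.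
Qed.

(** The two pairs have a product law, and each point has density [a^-1] on [G], whence the factor
    [a ^+ 4]. *)
Theorem four_point_probability (s : L * L -> L * L -> L * L -> L * L -> bool) :
    (forall d' (T' : measurableType d') (a1 a2 a3 a4 : T' -> L * L),
      measurable_fun setT a1 -> measurable_fun setT a2 ->
      measurable_fun setT a3 -> measurable_fun setT a4 ->
      measurable_fun setT (fun x => s (a1 x) (a2 x) (a3 x) (a4 x))) ->
  P [set w | s (A w) (B w) (C w) (D w)] * (a ^+ 4)%:E =
  \int[mu2]_a1 \int[mu2]_a2 \int[mu2]_a3 \int[mu2]_a4
    quad_indic (fun x => x \in G) s a1 a2 a3 a4.
Proof.
move=> ms.
pose f (p q : (L * L) * (L * L)) : \bar R := (s p.1 p.2 q.1 q.2)%:R%:E.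
have f0 p q : 0 <= f p q by rewrite lee_fin.
have mGb := measurable_mem_set mG.
have mGc d' (T' : measurableType d') (g : T' -> L * L) : measurable_fun setT g ->
    measurable_fun setT (fun x => (g x \in G)).
  by move=> mg; exact: (measurableT_comp mGb mg).
have mf : measurable_fun setT (fun z => f z.1 z.2) by rewrite /f; meas.
pose S : set (((L * L) * (L * L)) * ((L * L) * (L * L))) :=
  [set z | s z.1.1 z.1.2 z.2.1 z.2.2].
have mS : measurable S.
  rewrite (_ : S = (fun z => s z.1.1 z.1.2 z.2.1 z.2.2) @^-1` [set true])//.
  rewrite -[X in measurable X]setTI.
  have : measurable_fun setT (fun z : ((L * L) * (L * L)) * ((L * L) * (L * L)) =>
    s z.1.1 z.1.2 z.2.1 z.2.2) by meas.
  exact.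
have -> : P [set w | s (A w) (B w) (C w) (D w)] =
    (distribution P (pair_RV A B) \x distribution P (pair_RV C D)) S.
  rewrite -(@law_pair _ _ _ _ _ _ _ _ (pair_RV A B) (pair_RV C D))//.
  exact: indep_pairs.
rewrite -[S in LHS]setIT.
rewrite -(integral_indic (distribution P (pair_RV A B) \x distribution P (pair_RV C D))%E
  measurableT mS).
transitivity ((\int[distribution P (pair_RV A B)]_p \int[distribution P (pair_RV C D)]_q f p q) *
  (a ^+ 4)%:E).
  rewrite -integral_prod//; congr (_ * _); apply: eq_integral => z _.
  have -> // : (\1_S z : R) = (s z.1.1 z.1.2 z.2.1 z.2.2)%:R.
  rewrite indicE (_ : (z \in S) = s z.1.1 z.1.2 z.2.1 z.2.2)//.
  by apply/idP/idP; rewrite inE.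
have AB E F : measurable E -> measurable F ->
    P (A @^-1` E `&` B @^-1` F) = P (A @^-1` E) * P (B @^-1` F).
  move=> mE mF; have := indep mE mF measurableT measurableT.
  by rewrite !preimage_setT !setIT !probability_setT !mule1.
have CD E F : measurable E -> measurable F ->
    P (C @^-1` E `&` D @^-1` F) = P (C @^-1` E) * P (D @^-1` F).
  move=> mE mF; have := indep measurableT measurableT mE mF.
  by rewrite !preimage_setT !setTI !probability_setT !mul1e.
pose K p := \int[mu2]_c \int[mu2]_d
  ((c \in G)%:R%:E * ((d \in G)%:R%:E * f p (c, d))).
have K0 p : 0 <= K p by rewrite /K; nonneg.
have mK d' (T' : measurableType d') (g : T' -> (L * L) * (L * L)) :
    measurable_fun setT g -> measurable_fun setT (fun x => K (g x)).
  move=> mg; have mK1 : measurable_fun setT K by rewrite /K /f /=; meas.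
  exact: (measurableT_comp mK1 mg).
have a2 : 0 <= (a^-1 ^+ 2)%:E by rewrite lee_fin exprn_ge0// invr_ge0 ltW.
transitivity ((\int[distribution P (pair_RV A B)]_p ((a^-1 ^+ 2)%:E * K (p.1, p.2))) *
  (a ^+ 4)%:E).
  congr (_ * _); apply: eq_integral => -[p1 p2] _.
  rewrite -(@integral_pair_law C D (fun c d => f (p1, p2) (c, d)) CD lC lD)//.
  by rewrite /f /=; meas.
rewrite ge0_integralZl//; last first.
  by apply: mK; meas.
rewrite (@integral_pair_law A B (fun x y => K (x, y)) AB lA lB)//; last first.
  by apply: mK; meas.
rewrite muleA muleC muleA -!EFinM (_ : _ * _ = 1)%R ?mul1e; last first.
  by field; rewrite gt_eqF.
apply: eq_integral => a1 _; apply: eq_integral => a2' _.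
rewrite muleA -EFinM /K -ge0_integralZl//; last 2 first.
- by rewrite /f /=; meas.
- by nonneg.
apply: eq_integral => a3 _; rewrite -ge0_integralZl//; last 2 first.
- by rewrite /f /=; meas.
- by nonneg.
apply: eq_integral => a4 _; rewrite /f /quad_indic -!EFinM /=.
by congr EFin; ring.
Qed.

End four_points.

(** * Comparison of the formula for [Omega] with that for a Borel set *)

Section comparison.
Variables (R : realType) (Omega : set (R * R)).
Local Notation L := (measurableTypeR R).
Local Notation mu := (@lebesgue_measure R).
Local Open Scope ereal_scope.

(** As [f] vanishes on the part of [D] outside [E], the range [[0, +oo[] can be compared with one
    that stops at the support function. *)
Lemma nonneg_le_integral_cut (D E : set L) (f g : L -> \bar R) :
    (forall x, D x -> 0 <= f x) -> (forall x, E x -> 0 <= g x) ->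
    (forall x, D x -> E x -> f x <= g x) -> (forall x, D x -> ~ E x -> f x = 0) ->
  \int[mu]_(x in D) f x <= \int[mu]_(x in E) g x.
Proof.
move=> f0 g0 fg f00; apply: nonneg_le_integral => // x; rewrite !patchE.
case: ifPn => [/set_mem Dx|_]; case: ifPn => [/set_mem Ex|nEx] //.
- exact: fg.
- by rewrite f00// => Ex; move/negP: nEx; apply; exact/mem_set.
- exact: g0.
Qed.

Lemma nonneg_le_integral_in (D : set L) (f g : L -> \bar R) :
    (forall x, D x -> 0 <= f x) -> (forall x, D x -> f x <= g x) ->
  \int[mu]_(x in D) f x <= \int[mu]_(x in D) g x.
Proof.
move=> f0 fg; apply: nonneg_le_integral_cut => [x Dx|x Dx|x Dx _|x Dx /(_ Dx)//].
- exact: f0.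
- exact: le_trans (f0 x Dx) (fg x Dx).
- exact: fg.
Qed.

Lemma cut_kernel_mono (D E : set L) (q : R) : D `<=` E ->
  \int[mu]_(u in D) \int[mu]_(v in D) (cut_weight u v q)%:E <=
  \int[mu]_(u in E) \int[mu]_(v in E) (cut_weight u v q)%:E.
Proof.
move=> DE; have c0 u v : 0 <= (cut_weight u v q)%:E by rewrite lee_fin cut_weight_ge0.
apply: nonneg_le_integral_cut => [u _|u _|u _ _|u /DE//].
- by apply: integral_ge0.
- by apply: integral_ge0.
by apply: nonneg_le_integral_cut => // v /DE.
Qed.

Lemma chord_kernel_ge0 r g q : 0 <= chord_kernel Omega r g q.
Proof.
apply: integral_ge0 => u _; apply: integral_ge0 => v _.
by rewrite lee_fin mulr_ge0.
Qed.

Lemma chord_kernelE r g q : chord_kernel Omega r g q =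
  \int[mu]_(u in chord Omega r g) \int[mu]_(v in chord Omega r g) (cut_weight u v q)%:E.
Proof. by rewrite /chord_kernel /cut_weight. Qed.

Section sets.
Variable (G : L * L -> bool).
Hypothesis mG : measurable_fun setT G.

Lemma chord_kernel_le r g q : (forall t, chord Omega r g t -> G (line_point r g t)) ->
  chord_kernel Omega r g q <= set_kernel G r g q.
Proof.
move=> h; rewrite chord_kernelE (set_kernelE mG).
by apply: cut_kernel_mono => t; exact: h.
Qed.

Lemma set_kernel_le r g q : (forall t, G (line_point r g t) -> chord Omega r g t) ->
  set_kernel G r g q <= chord_kernel Omega r g q.
Proof.
move=> h; rewrite chord_kernelE (set_kernelE mG).
by apply: cut_kernel_mono => t; exact: h.
Qed.

Lemma set_kernel_eq0 r g q : (forall t, ~ G (line_point r g t)) -> set_kernel G r g q = 0.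
Proof.
move=> h; rewrite set_kernelE// (_ : [set u | _] = set0) ?integral_set0//.
by apply/seteqP; split => // t /h.
Qed.

(** The integral of the final formula, with [c] standing for [sin theta]. *)
Definition chord_integral (c : R) : \bar R :=
  \int[mu]_(g1 in `[0%R, (2 * pi)%R]) \int[mu]_(g2 in `[0%R, (2 * pi)%R])
    ((`|sin (g1 - g2)| <= c)%R%:R%:E *
     \int[mu]_(r1 in `[0%R, support_fun Omega g1])
       \int[mu]_(r2 in `[0%R, support_fun Omega g2])
       (chord_kernel Omega r1 g1 (cut1 g1 g2 r1 r2) *
        chord_kernel Omega r2 g2 (cut2 g1 g2 r1 r2))).

Definition set_integral (c : R) : \bar R :=
  \int[mu]_(g1 in `[0%R, (2 * pi)%R]) \int[mu]_(g2 in `[0%R, (2 * pi)%R])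
    ((`|sin (g1 - g2)| <= c)%R%:R%:E *
     \int[mu]_(r1 in `[0%R, +oo[) \int[mu]_(r2 in `[0%R, +oo[)
       (set_kernel G r1 g1 (cut1 g1 g2 r1 r2) *
        set_kernel G r2 g2 (cut2 g1 g2 r1 r2))).

Let sk0 := @set_kernel_ge0 R G.
Let ck0 := chord_kernel_ge0.

Lemma chord_integral_le (c : R) :
    (forall r g t, chord Omega r g t -> G (line_point r g t)) ->
  chord_integral c <= set_integral c.
Proof.
move=> OG.
have sub h : `[0%R, h] `<=` (`[0%R, +oo[ : set R).
  by move=> x; rewrite /= !in_itv/= andbT => /andP[].
have ck_ge0 (D E : set L) g1 g2 : 0 <= \int[mu]_(r1 in D) \int[mu]_(r2 in E)
  (chord_kernel Omega r1 g1 (cut1 g1 g2 r1 r2) * chord_kernel Omega r2 g2 (cut2 g1 g2 r1 r2)).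
  by apply: integral_ge0 => ? _; apply: integral_ge0 => ? _; rewrite mule_ge0.
have sk_ge0 (D E : set L) g1 g2 : 0 <= \int[mu]_(r1 in D) \int[mu]_(r2 in E)
  (set_kernel G r1 g1 (cut1 g1 g2 r1 r2) * set_kernel G r2 g2 (cut2 g1 g2 r1 r2)).
  by apply: integral_ge0 => ? _; apply: integral_ge0 => ? _; rewrite mule_ge0.
apply: nonneg_le_integral_in => [g1 _|g1 _].
- by apply: integral_ge0 => g2 _; apply: mule_ge0; [rewrite lee_fin|exact: ck_ge0].
apply: nonneg_le_integral_in => [g2 _|g2 _].
- by apply: mule_ge0; [rewrite lee_fin|exact: ck_ge0].
apply: lee_wpmul2l; first by rewrite lee_fin.
apply: nonneg_le_integral_cut => [r1 _|r1 _|r1 _ _|r1 /sub//].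
- by apply: integral_ge0 => ? _; rewrite mule_ge0.
- by apply: integral_ge0 => ? _; rewrite mule_ge0.
apply: nonneg_le_integral_cut => [r2 _|r2 _|r2 _ _|r2 /sub//].
- by rewrite mule_ge0.
- by rewrite mule_ge0.
by apply: lee_pmul => //; apply: chord_kernel_le => t; exact: OG.
Qed.

Lemma set_integral_le (c : R) :
    (forall r g t, G (line_point r g t) -> chord Omega r g t) ->
    (forall r g t, G (line_point r g t) -> (r <= support_fun Omega g)%R) ->
  set_integral c <= chord_integral c.
Proof.
move=> GO Gh.
have ck_ge0 (D E : set L) g1 g2 : 0 <= \int[mu]_(r1 in D) \int[mu]_(r2 in E)
  (chord_kernel Omega r1 g1 (cut1 g1 g2 r1 r2) * chord_kernel Omega r2 g2 (cut2 g1 g2 r1 r2)).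
  by apply: integral_ge0 => ? _; apply: integral_ge0 => ? _; rewrite mule_ge0.
have sk_ge0 (D E : set L) g1 g2 : 0 <= \int[mu]_(r1 in D) \int[mu]_(r2 in E)
  (set_kernel G r1 g1 (cut1 g1 g2 r1 r2) * set_kernel G r2 g2 (cut2 g1 g2 r1 r2)).
  by apply: integral_ge0 => ? _; apply: integral_ge0 => ? _; rewrite mule_ge0.
have out (r g q : R) : `[0%R, +oo[%classic r -> ~ `[0%R, support_fun Omega g]%classic r ->
    set_kernel G r g q = 0.
  rewrite /= !in_itv/= andbT => r0 rh; apply: set_kernel_eq0 => t /Gh h.
  by apply: rh; rewrite r0.
apply: nonneg_le_integral_in => [g1 _|g1 _].
- by apply: integral_ge0 => g2 _; apply: mule_ge0; [rewrite lee_fin|exact: sk_ge0].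
apply: nonneg_le_integral_in => [g2 _|g2 _].
- by apply: mule_ge0; [rewrite lee_fin|exact: sk_ge0].
apply: lee_wpmul2l; first by rewrite lee_fin.
apply: nonneg_le_integral_cut => [r1 _|r1 _|r1 _ _|r1 h1 h2].
- by apply: integral_ge0 => ? _; rewrite mule_ge0.
- by apply: integral_ge0 => ? _; rewrite mule_ge0.
- apply: nonneg_le_integral_cut => [r2 _|r2 _|r2 _ _|r2 h1 h2].
  + by rewrite mule_ge0.
  + by rewrite mule_ge0.
  + by apply: lee_pmul => //; apply: set_kernel_le => t; exact: GO.
  + by rewrite [X in _ * X]out// mule0.
- by apply: integral0_eq => r2 _; rewrite out// mul0e.
Qed.

End sets.
End comparison.

(** * The crossing event and the conditional probability *)

Section planar_points.
Context (R : realType) d (T : measurableType d) (P : probability T R).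
Local Notation L := (measurableTypeR R).
Variable X : {RV P >-> (R * R)%type}.

(** The map [X] itself, retyped with values in the product of the measurable types that carry
    [lebesgue_measure]. *)
Definition planar_RV (w : T) : (L * L)%type := X w.

Lemma measurable_planar_RV : measurable_fun setT planar_RV.
Proof. exact: (measurable_funPT X). Qed.

HB.instance Definition _ := isMeasurableFun.Build _ _ _ _ planar_RV measurable_planar_RV.

End planar_points.

Lemma mutually_independent4 d d' (T : measurableType d) (U : measurableType d') (R : realType)
    (P : probability T R) (A B C D : {RV P >-> U}) :
    mutually_independent (fun i : 'I_4 => tnth [tuple A; B; C; D] i) ->
  forall E1 E2 E3 E4 : set U, measurable E1 -> measurable E2 -> measurable E3 -> measurable E4 ->
  (P (A @^-1` E1 `&` B @^-1` E2 `&` (C @^-1` E3 `&` D @^-1` E4)) =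
    P (A @^-1` E1) * P (B @^-1` E2) * (P (C @^-1` E3) * P (D @^-1` E4)))%E.
Proof.
move=> ind E1 E2 E3 E4 m1 m2 m3 m4.
have mE (i : 'I_4) : measurable (tnth [tuple E1; E2; E3; E4] i).
  by case: i => -[|[|[|[|//]]]] ?; rewrite (tnth_nth set0).
have := ind [set i : 'I_4 | true]%SET _ mE.
rewrite (eq_bigl xpredT); last by move=> i; rewrite inE.
rewrite 4!big_ord_recl big_ord0 mule1 !(tnth_nth A) !(tnth_nth set0) /=.
rewrite !muleA => <-; congr (P _).
apply/seteqP; split => w /=.
  move=> [[h1 h2] [h3 h4]] i _.
  by case: i => -[|[|[|[|//]]]] ?; rewrite /= !(tnth_nth A) !(tnth_nth set0).
move=> h.
have h' (i : nat) (i4 : (i < 4)%N) : (nth set0 [:: E1; E2; E3; E4] i) (nth A [:: A; B; C; D] i w).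
  have := h (Ordinal i4); rewrite /= inE => /(_ isT).
  by rewrite !(tnth_nth A) !(tnth_nth set0).
by split; split; [exact: (h' 0%N)|exact: (h' 1%N)|exact: (h' 2%N)|exact: (h' 3%N)].
Qed.

Definition crossing_event (R : realType) (theta : R) (a1 a2 a3 a4 : R * R) : bool :=
  `[< segment a1 a2 `&` segment a3 a4 !=set0 >] && (cos theta <= abs_cos (a2 - a1) (a4 - a3)).

Lemma measurable_crossing_event (R : realType) (theta : R) d (T : measurableType d)
    (a1 a2 a3 a4 : T -> measurableTypeR R * measurableTypeR R) :
  measurable_fun setT a1 -> measurable_fun setT a2 ->
  measurable_fun setT a3 -> measurable_fun setT a4 ->
  measurable_fun setT (fun x => crossing_event theta (a1 x) (a2 x) (a3 x) (a4 x)).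
Proof.
move=> m1 m2 m3 m4; apply: measurable_and; first exact: measurable_segments_meet.
apply: measurable_fun_ler; first exact: measurable_cst.
rewrite (_ : (fun x => _) = fun x => abs_cos ((a2 x).1 - (a1 x).1, (a2 x).2 - (a1 x).2)
  ((a4 x).1 - (a3 x).1, (a4 x).2 - (a3 x).2))//.
by apply: measurable_abs_cos; meas.
Qed.

Lemma crossing_event_line_point (R : realType) (theta g1 g2 r1 r2 u v u' v' : R) :
    0 <= theta <= pi / 2 -> sin (g1 - g2) != 0 -> u != v -> u' != v' ->
  crossing_event theta (line_point r1 g1 u) (line_point r1 g1 v)
    (line_point r2 g2 u') (line_point r2 g2 v') =
  [&& `|sin (g1 - g2)| <= sin theta,
      (u - cut1 g1 g2 r1 r2) * (v - cut1 g1 g2 r1 r2) <= 0 &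
      (u' - cut2 g1 g2 r1 r2) * (v' - cut2 g1 g2 r1 r2) <= 0].
Proof.
move=> thetaI s0 uv uv'; rewrite /crossing_event abs_cos_line_point// cos_le_norm_cos//.
rewrite andbC; congr (_ && _).
have [h1 h2] := @meet_line_point R g1 g2 r1 r2 u v u' v' s0.
by apply/asboolP/andP.
Qed.

Theorem theorem2p1 (R : realType) (Omega : set (R * R))
    (Omega_bounded : bounded_set Omega)
    (Omega_measurable : lebesgue_measurable_plane Omega)
    (Omega_area : (0 < area Omega)%E)
    (Omega_0 : Omega (0, 0))
    (Omega_star : star_shaped Omega)
    (d : measure_display) (T : measurableType d) (P : probability T R)
    (A B C D : {RV P >-> (R * R)%type})
    (ABCD_indep :
       mutually_independent (fun i : 'I_4 => tnth [tuple A; B; C; D] i))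
    (A_unif : uniform_on Omega A) (B_unif : uniform_on Omega B)
    (C_unif : uniform_on Omega C) (D_unif : uniform_on Omega D)
    (theta : R) (theta_range : 0 <= theta <= pi / 2) :
  let meet := [set w | segment (A w) (B w) `&` segment (C w) (D w) !=set0] in
  let Theta := fun w => smaller_angle (A w) (B w) (C w) (D w) in
  let mu := @lebesgue_measure R in
  cond_prob P [set w | Theta w <= theta] meet =
  ((P meet * area Omega ^+ 4)^-1 *
   \int[mu]_(gAB in `[0%R, (2 * pi)%R]) \int[mu]_(gCD in `[0%R, (2 * pi)%R])
     (((`|sin (gAB - gCD)| <= sin theta)%R%:R)%:E *
      \int[mu]_(rAB in `[0%R, support_fun Omega gAB])
      \int[mu]_(rCD in `[0%R, support_fun Omega gCD])
        (chord_kernel Omega rAB gAB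
           ((rAB * cos (gAB - gCD) - rCD) / sin (gAB - gCD))%R *
         chord_kernel Omega rCD gCD
           ((rAB - rCD * cos (gAB - gCD)) / sin (gAB - gCD))%R)))%E.
Proof.
move=> meet Theta mu.
pose L := measurableTypeR R.
have [a [aE a0]] : exists a : R, area Omega = a%:E /\ 0 < a.
  have aoo := area_lty Omega_bounded.
  exists (fine (area Omega)); rewrite fineK; first by rewrite fine_gt0// Omega_area.
  by rewrite ge0_fin_numE// ltW.
pose N := P [set w | crossing_event theta (A w) (B w) (C w) (D w)].
have law (X : {RV P >-> (R * R)%type}) (G : set (L * L)) : uniform_on Omega X ->
    (forall E : set (L * L), measurable E ->
      area (E `&` Omega) = @plane_measure R (E `&` G)) ->
    @scaled_law _ _ _ P G a (planar_RV X).
  move=> Xu GO E mE; rewrite -GO//.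
  transitivity (distribution P X E); first by [].
  by rewrite Xu// aE inver gt_eqF// muleC.
have indep (E1 E2 E3 E4 : set (L * L)) : measurable E1 -> measurable E2 ->
    measurable E3 -> measurable E4 ->
    (P (planar_RV A @^-1` E1 `&` planar_RV B @^-1` E2 `&`
        (planar_RV C @^-1` E3 `&` planar_RV D @^-1` E4)) =
    P (planar_RV A @^-1` E1) * P (planar_RV B @^-1` E2) *
      (P (planar_RV C @^-1` E3) * P (planar_RV D @^-1` E4)))%E.
  exact: (mutually_independent4 ABCD_indep).
have key (G : set (L * L)) : measurable G ->
    (forall E : set (L * L), measurable E ->
      area (E `&` Omega) = @plane_measure R (E `&` G)) ->
    (N * (a ^+ 4)%:E = set_integral (fun x => x \in G) (sin theta))%E.
  move=> mG GO.
  rewrite (@four_point_probability _ _ _ _ (planar_RV A) (planar_RV B) (planar_RV C)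
    (planar_RV D) G a a0 mG indep (law _ _ A_unif GO) (law _ _ B_unif GO)
    (law _ _ C_unif GO) (law _ _ D_unif GO) (crossing_event theta)); last first.
    exact: measurable_crossing_event.
  apply: integral_quadruple.
  - exact: measurable_mem_set.
  - exact: measurable_crossing_event.
  - by move=> *; exact: crossing_event_line_point.
have [G1 [mG1 G1O G1E]] := inner_plane_set Omega_bounded Omega_measurable.
have [G2 [mG2 G2O G2E]] := outer_plane_set Omega_bounded Omega_0 Omega_star.
have IE : (chord_integral Omega (sin theta) = N * (a ^+ 4)%:E)%E.
  apply/eqP; rewrite eq_le; apply/andP; split.
    rewrite (key _ mG2 G2E); apply: chord_integral_le; first exact: measurable_mem_set.
    by move=> r g t /G2O h; exact/mem_set.
  rewrite (key _ mG1 G1E); apply: set_integral_le; first exact: measurable_mem_set.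
    move=> r g t /set_mem/G1O h; exact: line_point_chord.
  by move=> r g t /set_mem/G1O h; exact: chord_le_support h.
rewrite -/(chord_integral Omega (sin theta)) IE aE.
have mmeet : measurable meet.
  have := @measurable_segments_meet R _ _ (planar_RV A) (planar_RV B) (planar_RV C)
    (planar_RV D) (measurable_planar_RV A) (measurable_planar_RV B)
    (measurable_planar_RV C) (measurable_planar_RV D) measurableT [set true] I.
  rewrite setTI (_ : _ @^-1` _ = meet)//.
  by apply/seteqP; split => w /=; [move/asboolP|move=> h; apply/asboolP].
have eventE : [set w | Theta w <= theta] `&` meet =
    [set w | crossing_event theta (A w) (B w) (C w) (D w)].
  apply/seteqP; split => w /=.
    move=> [h1 h2]; rewrite /crossing_event -smaller_angle_le// h1 andbT.
    exact/asboolP.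
  by rewrite /crossing_event -smaller_angle_le// => /andP[/asboolP].
have NE : P ([set w | Theta w <= theta] `&` meet) = N by rewrite eventE.
have Nle : (N <= P meet)%E.
  rewrite -NE; apply: le_measure; rewrite ?inE//.
  rewrite (_ : _ `&` _ = [set w | crossing_event theta (A w) (B w) (C w) (D w)]).
    have := @measurable_crossing_event R theta _ _ (planar_RV A) (planar_RV B)
      (planar_RV C) (planar_RV D) (measurable_planar_RV A) (measurable_planar_RV B)
      (measurable_planar_RV C) (measurable_planar_RV D) measurableT [set true] I.
    by rewrite setTI.
  exact: eventE.
have a40 : a ^+ 4 != 0 by rewrite expf_neq0// gt_eqF.
rewrite /cond_prob NE -EFin_expe.
have [p pE] : exists p, P meet = p%:E.
  by exists (fine (P meet)); rewrite fineK// fin_num_measure.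
(* If the segments almost surely do not meet, [N] is [0] and both sides are [0], whatever the
   inverse of [0] is. *)
have [p0|pn0] := eqVneq p 0.
  have -> : N = 0%E; last by rewrite !mul0e mule0.
  by apply/eqP; rewrite eq_le measure_ge0 andbT (le_trans Nle)// pE p0.
rewrite pE -EFinM !inver mulf_eq0 (negbTE pn0) (negbTE a40)/= muleCA -EFinM.
by rewrite invfM mulfVK.
Qed.
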